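(* Let $q$ be a power of $2$, and let $D$ be a derivation set on the line at infinity $\ell_\infty$ of $\mathrm{AG}(2,q^2)$. Let $K$ be either an ellipse, or a hyperbola such that the infinite points of $K$ are non-conjugate with respect to $D$ and none of them is contained in $D$. Then the number of new lines of the Hall plane $\mathrm{Hall}(q^2)$ obtained from $D$ that meet $K$ in exactly $3$ (affine) points is $a_3=q(q-1)/2$.
   Context: $\mathrm{AG}(2,q^2)=\mathrm{PG}(2,q^2)\setminus\ell_\infty$. A derivation set $D$ is a Baer subline of $\ell_\infty$, i.e. an image under a projectivity of $\ell_\infty$ of the standard one $\{(x:y:0)\mid x,y\in\mathrm{GF}(q),\ (x,y)\neq(0,0)\}$ (where $\ell_\infty: Z=0$). The affine Hall plane $\mathrm{Hall}(q^2)$ obtained from $D$ has as points the points of $\mathrm{AG}(2,q^2)$; its lines are the ''old lines'', i.e. the affine parts of the lines of $\mathrm{PG}(2,q^2)$ other than $\ell_\infty$ whose infinite point is not in $D$, and the ''new lines'', i.e. the affine parts $B\setminus\ell_\infty$ of the Baer subplanes $B$ (subplanes of order $q$) of $\mathrm{PG}(2,q^2)$ containing $D$. For the standard $D$ the new lines are the sets $\{(a+\lambda u,b+\lambda v): u,v\in\mathrm{GF}(q)\}$ with $a,b\in\mathrm{GF}(q^2)$, $\lambda\in\mathrm{GF}(q^2)^*$. Conic means irreducible conic. A conic of $\mathrm{PG}(2,q^2)$ is an ellipse or a hyperbola if it has exactly $0$ or $2$ points on $\ell_\infty$ (its infinite points), respectively. Two points of $\ell_\infty\setminus D$ are conjugate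 with respect to $D$ if, in a coordinate frame where $D$ is standard, they are interchanged by $(x:y:0)\mapsto(x^q:y^q:0)$. *)

(* Defs.v *)
From HB Require Import structures.
From mathcomp Require Import all_boot all_algebra.
From mathcomp Require Import mpoly.

Set Implicit Arguments.
Unset Strict Implicit.
Unset Printing Implicit Defensive.

Import GRing.Theory.
Local Open Scope ring_scope.

(** * The projective plane PG(2, F)

    A point is a one-dimensional subspace of F^3, represented as the finite set
    of its vectors; its homogeneous coordinate vectors are the nonzero ones. *)

Definition is_point (F : finFieldType) (P : {set 'rV[F]_3}) : bool :=
  [exists v : 'rV[F]_3, (v != 0) && (P == [set a *: v | a : F])].

Record point (F : finFieldType) : predArgType :=
  Point { vectors : {set 'rV[F]_3}; _ : is_point vectors }.

HB.instance Definition _ (F : finFieldType) := [isSub for @vectors F].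
HB.instance Definition _ (F : finFieldType) := [Finite of point F by <:].

Definition has_coords (F : finFieldType) (P : point F) (v : 'rV[F]_3) : bool :=
  (v != 0) && (v \in vectors P).

Definition line (F : finFieldType) (w : 'rV[F]_3) : {set point F} :=
  [set P | [forall v in vectors P, v *m w^T == 0]].

Definition lines (F : finFieldType) : {set {set point F}} :=
  [set line w | w : 'rV[F]_3 & w != 0].

(** Z = 0 *)
Definition line_at_infinity (F : finFieldType) : {set point F} :=
  line (delta_mx 0 ord_max).

Arguments lines F : clear implicits.
Arguments line_at_infinity F : clear implicits.

(** * Baer subplanes *)

(** The points of [B] and the lines of [Ls], with the inherited incidence, form
    a projective plane of order [n]. *)
Definition projective_plane (T : finType) (n : nat)
    (B : {set T}) (Ls : {set {set T}}) : bool :=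
  [&& [forall P in B, forall Q in B, (P != Q) ==>
         (#|[set L in Ls | (P \in L) && (Q \in L)]| == 1%N)],
      [forall L in Ls, forall M in Ls, (L != M) ==> (#|B :&: L :&: M| == 1%N)],
      [exists S : {set T}, [&& S \subset B, #|S| == 4%N
         & [forall L in Ls, (#|S :&: L| <= 2)%N]]]
    & [forall L in Ls, #|B :&: L| == n.+1]].

Definition subplane (F : finFieldType) (n : nat) (B : {set point F}) : bool :=
  [exists Ls : {set {set point F}},
     (Ls \subset lines F) && projective_plane n B Ls].

(** * Derivation sets and Hall planes

    Throughout, #|F| = q ^ 2, so that GF(q) = {x | x ^+ q = x}. A point
    (x : y : 0) of the line at infinity is given by the row vector (x, y), and
    a projectivity of that line by an invertible 2 x 2 matrix [A]. *)

Definition frobenius (F : finFieldType) (q : nat) (v : 'rV[F]_2) : 'rV[F]_2 :=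
  map_mx (fun x => x ^+ q) v.

Definition infinite_point (F : finFieldType) (P : point F) (v : 'rV[F]_2) :
    bool :=
  has_coords P (row_mx v (0 : 'rV[F]_1)).

(** The image under [A] of {(x : y : 0) | x, y \in GF(q), (x, y) != (0, 0)}. *)
Definition baer_subline (F : finFieldType) (q : nat) (A : 'M[F]_2) :
    {set point F} :=
  [set P | [exists v : 'rV[F]_2,
     [&& v != 0, frobenius q v == v & infinite_point P (v *m A)]]].

Definition derivation_set (F : finFieldType) (q : nat) (D : {set point F}) :
    Prop :=
  exists2 A : 'M[F]_2, A \in unitmx & D = baer_subline q A.

(** In the frame of the line at infinity given by [A] the set [D] is standard,
    and [P], [Q] are interchanged by (x : y : 0) |-> (x^q : y^q : 0). *)
Definition conjugate_points (F : finFieldType) (q : nat) (D : {set point F})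
    (P Q : point F) : Prop :=
  exists A : 'M[F]_2, [/\ A \in unitmx, D = baer_subline q A
    & exists v : 'rV[F]_2,
        infinite_point P (v *m A) /\ infinite_point Q (frobenius q v *m A)].

Definition new_lines (F : finFieldType) (q : nat) (D : {set point F}) :
    {set {set point F}} :=
  [set B :\: line_at_infinity F
    | B in [set B : {set point F} | subplane q B && (D \subset B)]].

(** * Conics *)

Definition irreducible_mpoly (n : nat) (L : fieldType) (f : {mpoly L[n]}) :
    Prop :=
  [/\ f != 0, f \isn't a GRing.unit
    & forall g h : {mpoly L[n]}, f = g * h ->
        g \is a GRing.unit \/ h \is a GRing.unit].

(** A conic is irreducible over every extension field: a product of two
    conjugate linear forms over a quadratic extension of F is excluded. *)
Definition absolutely_irreducible (n : nat) (F : fieldType)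
    (f : {mpoly F[n]}) : Prop :=
  forall (L : fieldType) (iota : {rmorphism F -> L}),
    irreducible_mpoly (map_mpoly iota f).

Definition zero_set (F : finFieldType) (f : {mpoly F[3]}) : {set point F} :=
  [set P | [forall v in vectors P, f.@[fun i => (v : 'rV[F]_3) 0 i] == 0]].

Definition conic (F : finFieldType) (K : {set point F}) : Prop :=
  exists f : {mpoly F[3]},
    [/\ f \is 2.-homog, absolutely_irreducible f & K = zero_set f].

Definition infinite_points (F : finFieldType) (K : {set point F}) :
    {set point F} :=
  K :&: line_at_infinity F.

Definition ellipse (F : finFieldType) (K : {set point F}) : Prop :=
  conic K /\ #|infinite_points K| = 0%N.

Definition hyperbola (F : finFieldType) (K : {set point F}) : Prop :=
  conic K /\ #|infinite_points K| = 2%N.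

(* Main.v *)
Require Import Defs.
From HB Require Import structures.
From mathcomp Require Import all_boot all_algebra all_field.
From mathcomp Require Import mpoly ring.

Set Implicit Arguments.
Unset Strict Implicit.
Unset Printing Implicit Defensive.

Import GRing.Theory.

(** Every line through the nucleus of a conic K of even order is a tangent.
    Choose affine coordinates with the nucleus as origin (it is affine, because
    the number of infinite points is 0 or 2), and write U for GF(q)^2; new lines
    are then the sets a + l U with a in GF(q^2)^2 and l nonzero. The form of K at
    infinity has no zero on U, and it is not proportional to a form over GF(q):
    such a form has its zeros in GF(q^2) ([artin_schreier]), and they are
    conjugate. A substitution over GF(q), which preserves the derivation set,
    therefore turns the affine part of K into N(x, y) = al x^2 + x y + y^2 = c
    with al outside GF(q) and c nonzero ([normal_form]).

    Modulo GF(q)^*, the values of N on U separate the q + 1 directions of U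
    except for the pairs {(1, t), (1, t + 1)} with t in GF(q) ([nform_class]).
    If B is the polar form of N and z is on K, then z + l v is another point of K
    iff l N(v) = B(v, z); its direction v determines l modulo GF(q)^*, namely by
    the classes of B(v, z) and N(v).

    Now let z be the point of contact of the tangent through the nucleus with a
    direction v0 in U. Then B(v, z) is B(v, v0) up to a constant, where B(v, v0)
    is in GF(q), so that two further points of K lie on a common new line through
    z iff N does not separate their directions. Hence z and a pair
    {(1, t), (1, t + 1)} not containing v0 give a new line with exactly three
    points of K ([card_threeline]), and z is the only point of contact with such
    a tangent on this line ([threeline_eq]). There are q - 1 directions v0 for
    each of the q / 2 pairs.

    Conversely, let z, z + l v, z + l w be points of K in a new line. If N
    separates the directions of all three sides v, w, v + w of this triangle,
    then a fourth point of K on the new line can be computed ([fourth_chord]).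
    Otherwise, the common vertex of two sides that are not separated is a point
    of contact as above ([threeline_special]). So all new lines that have exactly
    three points on K were counted.

    That the new lines are the sets a + l U is part of the proof: a subplane
    containing the derivation set is recovered from two of its affine points
    ([sub_affine]), and the points with GF(q)-rational coordinates in any frame
    form a subplane of order q ([frame_subplane]). *)

Lemma card_two_to_one (aT rT : finType) (f : aT -> rT) (A : {set aT}) :
  (forall x, x \in A -> #|[set y in A | f y == f x]| = 2%N) ->
  #|A| = (2 * #|f @: A|)%N.
Proof.
move=> fibre2; rewrite -sum1_card (partition_big_imset f) /=.
rewrite (eq_bigr (fun=> 2%N)); first by rewrite sum_nat_const mulnC.
move=> _ /imsetP[x xA ->]; rewrite -(fibre2 x xA) -sum1_card.
by apply: eq_bigl => y; rewrite inE.
Qed.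

(** * Characteristic 2 and the subfield GF(q) *)

Section HallPlane.

Local Open Scope ring_scope.

Variables (F : finFieldType) (q h : nat).
Hypotheses (h_gt0 : (0 < h)%N) (q_pow2 : q = (2 ^ h)%N)
           (cardF : #|F| = (q ^ 2)%N).

Lemma q_gt1 : (1 < q)%N.
Proof. by rewrite q_pow2 -{1}(expn0 2) ltn_exp2l ?h_gt0. Qed.

Lemma pcharF2 : 2%N \in [pchar F].
Proof.
by apply: (@card_finPcharP F 2 (h * 2)) => //; rewrite cardF q_pow2 expnM.
Qed.

Lemma two0 : 2 = 0 :> F.
Proof. exact: pcharf0 pcharF2. Qed.

Lemma oppF (x : F) : - x = x.
Proof. exact: oppr_pchar2 pcharF2 x. Qed.

Lemma eqF (x y : F) : x + y = 0 -> x = y.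
Proof. by move/eqP; rewrite addr_eq0 oppF => /eqP. Qed.

Lemma four0 : 4 = 0 :> F.
Proof. by rewrite (natrM _ 2 2) two0 mulr0. Qed.
Lemma six0 : 6 = 0 :> F.
Proof. by rewrite (natrM _ 3 2) two0 mulr0. Qed.
Lemma eight0 : 8 = 0 :> F.
Proof. by rewrite (natrM _ 4 2) two0 mulr0. Qed.

(* In the sum of two polynomials over the integers that agree modulo 2 all
   coefficients are even, and the ring tactic is told that they vanish. *)
Ltac char2 := apply: eqF; rewrite ?oppF; ring: two0 four0 six0 eight0.

Lemma q_nat : [pchar F].-nat q.
Proof. by rewrite q_pow2 pnatX (eq_pnat _ (pcharf_eq pcharF2)). Qed.

Lemma frD (x y : F) : (x + y) ^+ q = x ^+ q + y ^+ q.
Proof. exact: exprDn_pchar q_nat. Qed.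
Lemma frM (x y : F) : (x * y) ^+ q = x ^+ q * y ^+ q.
Proof. exact: exprMn. Qed.
Lemma frV (x : F) : (x^-1) ^+ q = (x ^+ q)^-1.
Proof. exact: exprVn. Qed.
Lemma frN (x : F) : (- x) ^+ q = - x ^+ q.
Proof. by rewrite !oppF. Qed.
Lemma frX2 (x : F) : (x ^+ 2) ^+ q = (x ^+ q) ^+ 2.
Proof. exact: exprAC. Qed.
Lemma fr1 : 1 ^+ q = 1 :> F.
Proof. exact: expr1n. Qed.
Lemma fr0 : 0 ^+ q = 0 :> F.
Proof. by rewrite expr0n gtn_eqF // ltnW // q_gt1. Qed.
Definition frE := (frD, frM, frV, frN, frX2, fr1, fr0).

Lemma frK (x : F) : (x ^+ q) ^+ q = x.
Proof. by rewrite -exprM mulnn -cardF expf_card. Qed.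

Definition GFq : {set F} := [set x | x ^+ q == x].

Lemma GFqP (x : F) : reflect (x ^+ q = x) (x \in GFq).
Proof. by rewrite inE; apply: eqP. Qed.

(** Squaring is the first of 2 h Frobenius steps that compose to the identity. *)
Definition sqrtF (x : F) : F := x ^+ (2 ^ (h * 2).-1).

Lemma sqrtFK (x : F) : sqrtF x ^+ 2 = x.
Proof.
rewrite /sqrtF -exprM -expnSr prednK ?muln_gt0 ?h_gt0 //.
by rewrite expnM -q_pow2 -cardF expf_card.
Qed.

Lemma sqr_inj (x y : F) : x ^+ 2 = y ^+ 2 -> x = y.
Proof.
move=> exy; apply: eqF; apply/eqP; rewrite -sqrf_eq0.
have -> : (x + y) ^+ 2 = x ^+ 2 + y ^+ 2 by char2.
by rewrite exy -mulr2n -mulr_natl two0 mul0r.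
Qed.

Lemma sqrtF_GFq (x : F) : x ^+ q = x -> sqrtF x ^+ q = sqrtF x.
Proof. by move=> xk; apply: sqr_inj; rewrite -frX2 sqrtFK xk. Qed.

(** Conjugating z = a + b x and adding the two equations determines b. *)
Lemma span_GFq (x z : F) : x ^+ q <> x ->
  exists a b, [/\ a ^+ q = a, b ^+ q = b & z = a + b * x].
Proof.
move=> xNk; have d0 : x + x ^+ q != 0.
  by apply/negP => /eqP /eqF e; apply: xNk; rewrite -e.
pose b := (z + z ^+ q) / (x + x ^+ q).
have bk : b ^+ q = b.
  by rewrite /b !frE !frK [z ^+ q + _]addrC [x ^+ q + _]addrC.
have eb : b * (x + x ^+ q) = z + z ^+ q by rewrite /b mulfVK.
move: b bk eb => b bk eb; exists (z + b * x), b; split=> //; last by char2.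
rewrite !frE bk; apply: eqF.
have -> : z ^+ q + b * x ^+ q + (z + b * x) = b * (x + x ^+ q) + (z + z ^+ q).
  by ring.
by rewrite eb; char2.
Qed.

Lemma card_GFq_le : (#|GFq| <= q)%N.
Proof.
have szP : size ('X^q - 'X : {poly F}) = q.+1.
  by rewrite size_polyDl ?size_polyXn // size_polyN size_polyX ltnS q_gt1.
have pn0 : 'X^q - 'X != 0 :> {poly F} by rewrite -size_poly_eq0 szP.
rewrite cardE -ltnS -szP; apply: max_poly_roots pn0 _ (enum_uniq _).
apply/allP => x; rewrite mem_enum => /GFqP xk.
by rewrite /root !hornerE /= ?hornerXn xk subrr.
Qed.

Lemma exists_notin_GFq : exists w : F, w ^+ q <> w.
Proof.
have /subsetPn[w _ wNk] : ~~ ([set: F] \subset GFq).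
  apply/negP => /subset_leq_card; rewrite cardsT cardF => le1.
  have := leq_trans le1 card_GFq_le.
  by rewrite -{2}(expn1 q) leq_exp2l ?q_gt1.
by exists w; apply/GFqP.
Qed.

(** GF(q)^2 covers GF(q^2), which has q^2 elements, by (a, b) |-> a + b w. *)
Lemma card_GFq : #|GFq| = q.
Proof.
apply/eqP; rewrite eqn_leq card_GFq_le /=.
have [w wNk] := exists_notin_GFq.
have sub : [set: F] \subset [set z.1 + z.2 * w | z in setX GFq GFq].
  apply/subsetP => z _; have [a [b [ak bk ez]]] := span_GFq z wNk.
  by apply/imsetP; exists (a, b); rewrite ?inE /= ?ak ?bk ?eqxx.
have := leq_trans (subset_leq_card sub) (leq_imset_card _ _).
by rewrite cardsX cardsT cardF -mulnn leqNgt -leqNgt leq_sqr.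
Qed.

(** GF(q^2) contains the roots of all Artin-Schreier polynomials over GF(q):
    t |-> t^2 + t is two-to-one from GF(q) u (th + GF(q)), where
    th + th^q = 1, into GF(q). *)
Lemma artin_schreier (n : F) : n ^+ q = n -> exists t : F, t ^+ 2 + t = n.
Proof.
move=> nk; have [w wNk] := exists_notin_GFq.
have d0 : w + w ^+ q != 0.
  by apply/negP => /eqP /eqF e; apply: wNk; rewrite -e.
pose th := w / (w + w ^+ q).
have thq : th ^+ q = th + 1.
  rewrite /th !frE !frK [w ^+ q + w]addrC.
  apply: (mulIf d0); rewrite mulrDl !mulfVK // mul1r; char2.
clearbody th; pose f (z : F * bool) := (z.1 + z.2%:R * th) ^+ 2 + (z.1 + z.2%:R * th).
pose A := setX GFq [set: bool].
have fib z : z \in A -> #|[set y in A | f y == f z]| = 2%N.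
  case: z => x b; rewrite !inE andbT /= => /eqP xk.
  have -> : [set y in A | f y == f (x, b)] = [set (x, b); (x + 1, b)].
    apply/setP => -[y c]; rewrite !inE !andbT /= !xpair_eqE.
    apply/andP/idP => [[/eqP yk /eqP]|]; last first.
      case/orP=> /andP[/eqP -> /eqP ->]; rewrite ?frE ?xk ?eqxx //; split=> //.
      by apply/eqP; rewrite /f /=; char2.
    rewrite /f /= => e.
    have e' : (y + x + (c%:R + b%:R) * th) * (y + x + (c%:R + b%:R) * th + 1) = 0.
      rewrite (_ : _ * _ = ((y + c%:R * th) ^+ 2 + (y + c%:R * th))
                 + ((x + b%:R * th) ^+ 2 + (x + b%:R * th))); last by char2.
      by rewrite e; char2.
    have [cb|ncb] := eqVneq c b.
      subst c; move: e'; rewrite !andbT.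
      rewrite (_ : (b%:R + b%:R) * th = 0) ?addr0; last by char2.
      move/eqP; rewrite mulf_eq0 => /orP[] /eqP /eqF; first by move->; rewrite eqxx.
      move=> e2; apply/orP; right; apply/eqP; rewrite -e2; char2.
    have cb1 : c%:R + b%:R = 1 :> F.
      by case: (c) (b) ncb => -[] // _; rewrite ?addr0 ?add0r.
    have two : (y + x + th) + (y + x + th + 1) != 0.
      rewrite (_ : _ + _ = 1) ?oner_eq0 //; char2.
    move: e'; rewrite cb1 mul1r => /eqP; rewrite mulf_eq0 => /orP[] /eqP e2;
      move: (congr1 (fun z : F => z ^+ q) e2);
      rewrite !frE yk xk thq addrA => e3; case/eqP: two.
      by rewrite e3 e2 addr0.
    rewrite e2 addr0 -[RHS]e3; char2.
  rewrite cards2 xpair_eqE eqxx andbT.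
  by rewrite -subr_eq0 opprD addNKr oppr_eq0 oner_eq0.
have cardA : #|A| = (2 * q)%N by rewrite cardsX cardsT card_bool card_GFq mulnC.
have := card_two_to_one fib; rewrite cardA => /eqP; rewrite eqn_pmul2l // => /eqP ec.
have sub : f @: A \subset GFq.
  apply/subsetP => _ /imsetP[[x b] + ->]; rewrite !inE andbT /= => /eqP xk.
  rewrite /f /= !frE xk thq.
  case: b => /=; rewrite ?fr1 ?fr0 ?mul1r ?mul0r //; apply/eqP; char2.
have := subset_cardP _ sub; rewrite -ec card_GFq => /(_ erefl) => ek.
have : n \in f @: A by rewrite ek; apply/GFqP.
by case/imsetP => z _ ->; exists (z.1 + z.2%:R * th).
Qed.

(** * Directions of GF(q)^2 *)

Definition GFq_plane : {set F * F} := setX GFq GFq.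
Definition polar (u v : F * F) : F := u.1 * v.2 + u.2 * v.1.

Lemma GFq_planeP (u : F * F) :
  reflect (u.1 ^+ q = u.1 /\ u.2 ^+ q = u.2) (u \in GFq_plane).
Proof. by rewrite !inE; apply: (iffP andP) => -[/eqP ? /eqP ?]. Qed.

(** The points at infinity of GF(q)^2, None being the vertical direction. *)
Definition dir (o : option F) : F * F := if o is Some y then (1, y) else (0, 1).
Definition dirs : {set option F} := None |: [set Some y | y in GFq].

Lemma card_dirs : #|dirs| = q.+1.
Proof.
rewrite cardsU1 card_imset; last by move=> ? ? [].
by rewrite card_GFq; case: imsetP => // -[].
Qed.

Lemma dirsP o : o \in dirs -> dir o \in GFq_plane.
Proof.
case/setU1P=> [->|/imsetP[y /GFqP yk ->]]; apply/GFq_planeP; by rewrite /= ?frE.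
Qed.

Lemma Some_dirs y : (Some y \in dirs) = (y \in GFq).
Proof. by rewrite in_setU1 /= mem_imset //; move=> ? ? []. Qed.

Lemma polar_dir o o' : polar (dir o) (dir o') = 0 -> o = o'.
Proof.
case: o o' => [y|] [y'|]; rewrite /polar /= ?(mulr0, mul0r, mulr1, mul1r, addr0, add0r) //.
- by rewrite addrC => /eqF ->.
- by move/eqP; rewrite oner_eq0.
- by move/eqP; rewrite oner_eq0.
Qed.

(** * New lines meeting a conic in normal form *)

Section Counting.

Variables (al c : F).
Hypotheses (alNk : al ^+ q <> al) (c_neq0 : c != 0).

Definition nform (z : F * F) : F := al * z.1 ^+ 2 + z.1 * z.2 + z.2 ^+ 2.
Definition shift (p : F * F) (l : F) (u : F * F) : F * F :=
  (p.1 + l * u.1, p.2 + l * u.2).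
(** The new lines, for the standard derivation set. *)
Definition subaff (p : F * F) (l : F) : {set F * F} :=
  [set shift p l u | u in GFq_plane].
Definition subaffs : {set {set F * F}} :=
  [set subaff p.1 p.2 | p : (F * F) * F & p.2 != 0].
Definition quadric : {set F * F} := [set z | nform z == c].

Lemma al_free (a b : F) : a ^+ q = a -> b ^+ q = b -> al * a + b = 0 ->
  a = 0 /\ b = 0.
Proof.
move=> ak bk e; have [a0|a0] := eqVneq a 0.
  by split=> //; rewrite -e a0 mulr0 add0r.
case: alNk; have -> : al = b / a.
  by apply: (mulIf a0); rewrite mulfVK //; apply: eqF.
by rewrite !frE ak bk.
Qed.

Lemma nform_shift p l u :
  nform (shift p l u) = nform p + l * polar u p + l ^+ 2 * nform u.
Proof. by rewrite /nform /polar /=; char2. Qed.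

Lemma nform_eq0 u : u \in GFq_plane -> nform u = 0 -> u = (0, 0).
Proof.
case: u => x y /GFq_planeP[/= xk yk]; rewrite /nform /= -addrA => e.
have [||/eqP x0 e2] := al_free _ _ e; rewrite ?frE ?xk ?yk //.
move: x0 e2; rewrite sqrf_eq0 => /eqP ->; rewrite mul0r add0r => /eqP.
by rewrite sqrf_eq0 => /eqP ->.
Qed.

(** Modulo GF(q)^*, the form nform is constant only on pairs of directions
    (1, y), (1, y + 1): comparing the coefficients of al and 1 in
    nform u = k nform v gives w^2 = u_1 v_1 w for w = polar u v. *)
Lemma nform_class u v k : u \in GFq_plane -> v \in GFq_plane -> k ^+ q = k ->
  nform u = k * nform v -> polar u v = 0 \/ polar u v = u.1 * v.1.
Proof.
case: u v => [u1 u2] [v1 v2] /GFq_planeP[/= u1k u2k] /GFq_planeP[/= v1k v2k] kk.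
rewrite /nform /polar /= => e.
have [|||e1 e2] := @al_free (u1 ^+ 2 + k * v1 ^+ 2)
    (u1 * u2 + u2 ^+ 2 + k * (v1 * v2 + v2 ^+ 2)).
- by rewrite !frE u1k v1k kk.
- by rewrite !frE u1k u2k v1k v2k kk.
- transitivity (al * u1 ^+ 2 + u1 * u2 + u2 ^+ 2 +
                k * (al * v1 ^+ 2 + v1 * v2 + v2 ^+ 2)); first by ring.
  by rewrite e; char2.
have : (u1 * v2 + u2 * v1) * (u1 * v2 + u2 * v1 + u1 * v1) = 0.
  transitivity (v1 ^+ 2 * (u1 * u2 + u2 ^+ 2 + k * (v1 * v2 + v2 ^+ 2)) +
                (v1 * v2 + v2 ^+ 2) * (u1 ^+ 2 + k * v1 ^+ 2)); first by char2.
  by rewrite e1 e2 !mulr0 addr0.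
by move/eqP; rewrite mulf_eq0 => /orP[] /eqP; [left | move/eqF; right].
Qed.

Lemma shift_inj p l : l != 0 -> injective (shift p l).
Proof.
move=> l0 [x y] [x' y'] [/addrI/(mulfI l0) <- /addrI/(mulfI l0) <-] //.
Qed.

Lemma card_subaff_quadric p l : l != 0 ->
  #|subaff p l :&: quadric| = #|[set u in GFq_plane | nform (shift p l u) == c]|.
Proof.
move=> l0; rewrite -[RHS](card_imset _ (@shift_inj p l l0)); apply: eq_card => z.
apply/setIP/imsetP.
  by case=> /imsetP[u uk ->]; rewrite inE => e; exists u; rewrite // inE uk.
by case=> u; rewrite inE => /andP[uk e] ->; rewrite inE e; split=> //; apply: imset_f.
Qed.

Lemma subaff_scale p l k : k != 0 -> k ^+ q = k -> subaff p (l * k) = subaff p l.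
Proof.
have sub l' k' : k' ^+ q = k' -> subaff p (l' * k') \subset subaff p l'.
  move=> kk; apply/subsetP => _ /imsetP[u /GFq_planeP[u1 u2] ->].
  apply/imsetP; exists (k' * u.1, k' * u.2).
    by apply/GFq_planeP; rewrite /= !frE kk u1 u2.
  by rewrite /shift /= !mulrA.
move=> k0 kk; apply/eqP; rewrite eqEsubset sub //=.
by rewrite -{1}[l](mulfK k0) sub // !frE kk.
Qed.

Lemma subaff_recenter p l u : u \in GFq_plane ->
  subaff (shift p l u) l = subaff p l.
Proof.
have sub p' u' : u' \in GFq_plane -> subaff (shift p' l u') l \subset subaff p' l.
  move=> /GFq_planeP[u1 u2]; apply/subsetP => _ /imsetP[v /GFq_planeP[v1 v2] ->].
  apply/imsetP; exists (u'.1 + v.1, u'.2 + v.2).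
    by apply/GFq_planeP; rewrite /= !frE u1 u2 v1 v2.
  by rewrite /shift /=; congr (_, _); ring.
move=> uk; apply/eqP; rewrite eqEsubset sub //=.
have {1}-> : p = shift (shift p l u) l u.
  by case: p => x y; rewrite /shift /=; congr (_, _); char2.
exact: sub.
Qed.

Lemma nform_dir o : o \in dirs -> nform (dir o) != 0.
Proof.
move=> /dirsP ok; apply/eqP => /(nform_eq0 ok).
by case: o ok => [y|] _ [] /eqP; rewrite ?oner_eq0 // => _ /eqP; rewrite oner_eq0.
Qed.

(** The line through the nucleus (0, 0) with direction dir o is a tangent of the
    quadric, and tangency o is its point of contact. *)
Definition tau (o : option F) : F := sqrtF (c / nform (dir o)).
Definition tangency (o : option F) : F * F :=
  (tau o * (dir o).1, tau o * (dir o).2).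

Lemma tau_neq0 o : o \in dirs -> tau o != 0.
Proof.
move=> ok; apply/eqP => e; have := sqrtFK (c / nform (dir o)).
rewrite -/(tau o) e expr0n /= => /esym/eqP; rewrite mulf_eq0 invr_eq0.
by rewrite (negPf c_neq0) (negPf (nform_dir ok)).
Qed.

Lemma nformZ a u : nform (a * u.1, a * u.2) = a ^+ 2 * nform u.
Proof. by rewrite /nform /=; ring. Qed.

Lemma nform_tangency o : o \in dirs -> nform (tangency o) = c.
Proof. by move=> ok; rewrite nformZ sqrtFK mulfVK // nform_dir. Qed.

(** The scales l of new lines through z = tangency o on which the
    quadric has a further point z + l v satisfy l * nform v = polar v z, and
    polar v z is tau o times an element of GF(q). *)
Definition threeline (t : F) (o : option F) : {set F * F} :=
  subaff (tangency o) (tau o / nform (1, t)).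
(** A direction o together with a pair {(1, t), (1, t + 1)} of other directions;
    the pair is given by either of its two members. *)
Definition config : {set F * option F} :=
  [set x | [&& x.1 \in GFq, x.2 \in dirs, x.2 != Some x.1
             & x.2 != Some (x.1 + 1)]].

Lemma GFqS t : t \in GFq -> t + 1 \in GFq.
Proof. by move/GFqP => tk; apply/GFqP; rewrite !frE tk. Qed.

Lemma card_config : #|config| = (q * (q - 1))%N.
Proof.
rewrite -sum1_card; under eq_bigl do rewrite inE.
rewrite -(pair_big_dep (fun t => t \in GFq)
  (fun t o => [&& o \in dirs, o != Some t & o != Some (t + 1)])
  (fun _ _ => 1%N)) /=.
under eq_bigr => t tk.
  rewrite sum1dep_card (_ : [set _ | _] = dirs :\ Some t :\ Some (t + 1)); last first.
    apply/setP => o; rewrite 2!in_setD1 in_set andbC andbA.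
    by rewrite [(_ != _) && (_ != _)]andbC.
  over.
rewrite /= -{1}card_GFq -sum_nat_const; apply: eq_bigr => t tk.
have := cardsD1 (Some t) dirs; rewrite Some_dirs tk card_dirs.
have := cardsD1 (Some (t + 1)) (dirs :\ Some t).
rewrite in_setD1 Some_dirs GFqS // andbT.
have -> : (Some (t + 1) != Some t).
  by apply/eqP => -[] /eqP; rewrite -subr_eq0 addrC addKr oner_eq0.
by move=> -> [] ->; rewrite subn1.
Qed.

Lemma nform_dirS t : nform (1, t + 1) = nform (1, t).
Proof. by rewrite /nform /=; char2. Qed.

Lemma nform_dir_neq0 t : t \in GFq -> nform (1, t) != 0.
Proof. by move=> tk; apply: (@nform_dir (Some t)); rewrite Some_dirs. Qed.

(** A further point of direction u satisfies polar u (dir o) * nform (1, t) =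
    nform u, so that u is proportional to (1, t) or (1, t + 1) by nform_class,
    and the equation then fixes the factor. *)
Lemma card_threeline x : x \in config -> #|threeline x.1 x.2 :&: quadric| = 3%N.
Proof.
case: x => t o; rewrite inE /= => /and4P[tk ok ot ot1].
have t0 := tau_neq0 ok; have n0 := nform_dir_neq0 tk.
have l0 : tau o / nform (1, t) != 0 by rewrite mulf_neq0 ?invr_eq0.
rewrite /threeline card_subaff_quadric //.
pose b s := polar (1, s) (dir o).
have bk s : s \in GFq -> b s ^+ q = b s.
  have /GFq_planeP[d1 d2] := dirsP ok.
  by move/GFqP => sk; rewrite /b /polar /= !frE d1 d2 sk.
have b0 s : o != Some s -> b s != 0.
  by move=> os; apply/eqP => /(@polar_dir (Some s)) e; case/eqP: os.
have onK u : (nform (shift (tangency o) (tau o / nform (1, t)) u) == c) =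
             (polar u (dir o) * nform (1, t) == nform u).
  rewrite nform_shift nform_tangency // -addrA -[X in _ == X]addr0 (inj_eq (addrI _)).
  have -> : tau o / nform (1, t) * polar u (tangency o) +
     (tau o / nform (1, t)) ^+ 2 * nform u =
     (tau o / nform (1, t)) ^+ 2 * (polar u (dir o) * nform (1, t) + nform u).
    by rewrite /polar /tangency /=; move: (nform u) => nu; field.
  by rewrite mulf_eq0 sqrf_eq0 (negPf l0) /= addr_eq0 oppF.
have tk1 := GFqS tk.
have -> : [set u in GFq_plane | nform (shift (tangency o) (tau o / nform (1, t)) u) == c]
   = [set (0, 0); (b t * 1, b t * t); (b (t + 1) * 1, b (t + 1) * (t + 1))].
  apply/setP => u; rewrite !in_setU !in_set1 inE onK.
  apply/andP/idP => [[uk /eqP e]|].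
    have [u00|un0] := eqVneq u (0, 0) => //.
    have bu0 : polar u (dir o) != 0.
      apply/eqP => p0; move: e; rewrite p0 mul0r => /esym /(nform_eq0 uk) /eqP.
      by rewrite (negPf un0).
    have polark : polar u (dir o) ^+ q = polar u (dir o).
      have /GFq_planeP[d1 d2] := dirsP ok; have /GFq_planeP[u1 u2] := uk.
      by rewrite /polar /= !frE d1 d2 u1 u2.
    have ek : (1, t) \in GFq_plane.
      by apply/GFq_planeP; rewrite /= !frE (GFqP _ tk).
    have eu s : nform (1, s) = nform (1, t) -> u.2 = u.1 * s ->
        u = (b s * 1, b s * s).
      move=> ens u2; have eu : u = (u.1 * 1, u.1 * s).
        by rewrite mulr1 -u2; case: (u).
      have u10 : u.1 != 0.
        by apply: contra_neq un0 => u10; rewrite eu u10 !mul0r.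
      rewrite {1}eu; suff -> : u.1 = b s by [].
      apply: (mulfI u10); apply: (mulIf n0).
      rewrite -{1}ens -expr2 -(nformZ u.1 (1, s)) -eu -e /b.
      by congr (_ * _); rewrite {1}eu /polar /=; ring.
    have := @nform_class u (1, t) _ uk ek polark (esym e).
    rewrite [polar u (1, t)]/polar /= [u.2 * 1]mulr1 [u.1 * 1]mulr1.
    case=> [/eqF|] e2.
      by rewrite -(eu t) // eqxx ?orbT.
    rewrite -(eu (t + 1)) ?nform_dirS // ?eqxx ?orbT //.
    have e3 : u.1 * t + u.2 + u.1 = 0 by rewrite e2; char2.
    by apply: eqF; rewrite -[RHS]e3; ring.
  have bs s : s \in GFq -> nform (1, s) = nform (1, t) ->
      (b s * 1, b s * s) \in GFq_plane /\
      polar (b s * 1, b s * s) (dir o) * nform (1, t) == nform (b s * 1, b s * s).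
    move=> sk ens; split.
      by apply/GFq_planeP; rewrite /= !frM fr1 bk // (GFqP _ sk).
    rewrite (nformZ (b s) (1, s)) ens expr2; apply/eqP; congr (_ * _).
    by rewrite {3}/b /polar /=; ring.
  rewrite -orbA => /or3P[] /eqP ->; [|exact: bs|by apply: bs; rewrite ?nform_dirS].
  split; first by apply/GFq_planeP; rewrite /= !frE.
  by rewrite /nform /polar /= !mul0r expr0n /= !(mulr0, mul0r, addr0).
rewrite -setUA cardsU1 cards2 !in_setU !in_set1 !xpair_eqE !mulr1.
rewrite ![0 == _]eq_sym !(negPf (b0 _ _)) //=.
have [e1|//] /= := eqVneq (b t) (b (t + 1)).
rewrite -e1 (inj_eq (mulfI (b0 _ ot))) -subr_eq0 opprD addNKr oppr_eq0.
by rewrite oner_eq0.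
Qed.

(** A line threeline t o has only one point that is proportional to a vector of
    GF(q)^2, and it determines o; the scale of the line then determines t up to
    t |-> t + 1. *)
Lemma threeline_eq x y : x \in config -> y \in config ->
  threeline x.1 x.2 = threeline y.1 y.2 ->
  x.2 = y.2 /\ (y.1 = x.1 \/ y.1 = x.1 + 1).
Proof.
case: x y => [t o] [t' o']; rewrite ![_ \in config]inE /=.
move=> /and4P[tk ok ot ot1] /and4P[tk' ok' ot' ot1'] e.
have n0 := nform_dir_neq0 tk; have n0' := nform_dir_neq0 tk'.
have /GFq_planeP[d1 d2] := dirsP ok; have /GFq_planeP[d1' d2'] := dirsP ok'.
have zk : (0, 0) \in GFq_plane by apply/GFq_planeP; rewrite /= !frE.
have eo : o = o'.
  have : tangency o' \in threeline t o.
    rewrite e; apply/imsetP; exists (0, 0) => //.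
    by rewrite /shift /= !mulr0 !addr0.
  case/imsetP=> u /GFq_planeP[u1 u2] [e1 e2]; apply: polar_dir.
  have t0 := tau_neq0 ok.
  have : (al + (t + t ^+ 2)) * polar (dir o) (dir o') + polar u (dir o') = 0.
    have -> : al + (t + t ^+ 2) = nform (1, t) by rewrite /nform /=; ring.
    apply: (mulfI (mulf_neq0 t0 (invr_neq0 n0))); rewrite mulr0.
    transitivity ((tau o * (dir o).1 + tau o / nform (1, t) * u.1) * (dir o').2
       + (tau o * (dir o).2 + tau o / nform (1, t) * u.2) * (dir o').1).
      by rewrite /polar; field.
    by rewrite -e1 -e2; char2.
  have -> (p : F) : (al + (t + t ^+ 2)) * p + polar u (dir o') =
     al * p + ((t + t ^+ 2) * p + polar u (dir o')) by ring.
  case/al_free=> //; rewrite /polar !frE ?d1 ?d2 ?d1' ?d2' //.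
  by rewrite u1 u2 (GFqP _ tk).
rewrite -eo in e *; split=> //.
have : shift (tangency o) (tau o / nform (1, t')) (1, 0) \in threeline t o.
  rewrite e; apply: imset_f; apply/GFq_planeP; by rewrite /= !frE.
case/imsetP=> u /GFq_planeP[u1 u2] [/addrI e1 _].
have e2 : nform (1, t) = u.1 * nform (1, t').
  have t0 := tau_neq0 ok.
  apply: (mulfI (mulf_neq0 t0 (mulf_neq0 (invr_neq0 n0) (invr_neq0 n0')))).
  transitivity (tau o / nform (1, t') * 1); first by field; rewrite n0 n0'.
  by rewrite e1; field; rewrite n0 n0'.
have [|||] := @nform_class (1, t) (1, t') u.1 _ _ u1 e2.
- by apply/GFq_planeP; rewrite /= !frE (GFqP _ tk).
- by apply/GFq_planeP; rewrite /= !frE (GFqP _ tk').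
- by rewrite /polar /= mul1r mulr1 => /eqF ->; left.
- by rewrite /polar /= mul1r mulr1 => e3; right; rewrite -e3; char2.
Qed.

Lemma polar_eq0 u v : u \in GFq_plane -> v \in GFq_plane -> u != (0, 0) ->
  polar u v = 0 -> exists2 m, m ^+ q = m & v = (m * u.1, m * u.2).
Proof.
case: u v => [u1 u2] [v1 v2] /GFq_planeP[/= u1k u2k] /GFq_planeP[/= v1k v2k] u0.
rewrite /polar /= => /eqF e.
have [u10|u10] := eqVneq u1 0; last first.
  exists (v1 / u1); first by rewrite !frE v1k u1k.
  by congr (_, _); [field | apply: (mulfI u10); rewrite e; field].
have u20 : u2 != 0 by apply: contra_neq u0 => u20; rewrite u10 u20.
exists (v2 / u2); first by rewrite !frE v2k u2k.
congr (_, _); last by field.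
by apply: (mulfI u20); rewrite -e u10 !(mul0r, mulr0).
Qed.

(** For z on the quadric and l nonzero this means that shift z l v is another
    point of the quadric. *)
Definition chord z l v := [&& v \in GFq_plane, v != (0, 0) & l * nform v == polar v z].

Lemma chordE z l v : l != 0 -> nform z = c -> v != (0, 0) ->
  chord z l v = (v \in [set u in GFq_plane | nform (shift z l u) == c]).
Proof.
move=> l0 zc v0; rewrite /chord [RHS]in_set v0 nform_shift zc /=; congr (_ && _).
rewrite -addrA -[X in _ = (_ == X)]addr0 (inj_eq (addrI _)).
rewrite (_ : l * _ + _ = l * (polar v z + l * nform v)); last by ring.
by rewrite mulf_eq0 (negPf l0) addr_eq0 oppF eq_sym.
Qed.

Lemma chord_indep z l v w : l != 0 -> chord z l v -> chord z l w -> v != w ->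
  polar v w != 0.
Proof.
move=> l0 /and3P[vk v0 /eqP ev] /and3P[wk w0 /eqP ew] vw; apply/eqP => p0.
have [m mk em] := polar_eq0 vk wk v0 p0.
have m0 : m != 0 by apply: contra_neq w0 => m0; rewrite em m0 !mul0r.
have nv0 : nform v != 0 by apply: contra_neq v0 => /(nform_eq0 vk).
suff m1 : m = 1 by case/eqP: vw; rewrite em m1 !mul1r; case: (v).
apply: (mulfI m0); apply: (mulfI (mulf_neq0 l0 nv0)).
transitivity (l * nform w); first by rewrite em nformZ; ring.
by rewrite ew mulr1 em ev /polar /=; ring.
Qed.

(** The chords v and w from z are GF(q)-multiples of (1, t) and (1, t + 1), on
    which nform takes the same value; their equations are linear in z and show
    that z is proportional to a vector of GF(q)^2, hence a point of contact. *)
Lemma threeline_special z l v w k : l != 0 -> nform z = c ->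
  chord z l v -> chord z l w -> v != w -> k ^+ q = k -> nform w = k * nform v ->
  exists2 x, x \in config & subaff z l = threeline x.1 x.2.
Proof.
move=> l0 zc cv cw vw kk ewv.
have p0 := chord_indep l0 cw cv; rewrite eq_sym in p0; move: (p0 vw) => {}p0.
move: (cv) (cw) => /and3P[vk v0 /eqP ev] /and3P[wk w0 /eqP ew].
have [/eqP|epol] := nform_class wk vk kk ewv; first by rewrite (negPf p0).
have := p0; rewrite epol mulf_eq0 => /norP[w10 v10].
move: vk wk => /GFq_planeP[v1k v2k] /GFq_planeP[w1k w2k].
pose t := v.2 / v.1; have tk : t ^+ q = t by rewrite /t !frE v1k v2k.
have tG : t \in GFq by apply/GFqP.
have ev1 : v = (v.1 * 1, v.1 * t).
  by rewrite {1}[v]surjective_pairing mulr1 /t mulrC mulfVK.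
have ew1 : w = (w.1 * 1, w.1 * (t + 1)).
  rewrite {1}[w]surjective_pairing mulr1; congr (_, _).
  apply: (mulIf v10); rewrite -mulrA mulrDl mul1r /t mulfVK // mulrDr -epol.
  by rewrite /polar; char2.
pose n := nform (1, t); have n0 : n != 0 by apply: nform_dir_neq0.
have e1 : l * n * v.1 = z.2 + t * z.1.
  apply: (mulfI v10); transitivity (l * nform v).
    by rewrite ev1 (nformZ _ (1, t)) /= -/n; ring.
  by rewrite ev ev1 /polar /=; ring.
have e2 : l * n * w.1 = z.2 + (t + 1) * z.1.
  apply: (mulfI w10); transitivity (l * nform w).
    by rewrite ew1 (nformZ _ (1, t + 1)) /= nform_dirS -/n; ring.
  by rewrite ew ew1 /polar /=; ring.
have z1 : z.1 = l * n * (v.1 + w.1) by rewrite mulrDr e1 e2; char2.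
have z2 : z.2 = l * n * (v.1 + t * (v.1 + w.1)).
  rewrite mulrDr e1 [t * (_ + _)]mulrC mulrA -z1; char2.
have finish o m : o \in dirs -> o != Some t -> o != Some (t + 1) ->
    m ^+ q = m -> m != 0 -> v.1 + w.1 = m * (dir o).1 ->
    v.1 + t * (v.1 + w.1) = m * (dir o).2 ->
    exists2 x, x \in config & subaff z l = threeline x.1 x.2.
  move=> ok ot ot1 mk m0 d1 d2; exists (t, o).
    by rewrite inE /= tG ok ot ot1.
  have ez : z = (l * n * m * (dir o).1, l * n * m * (dir o).2).
    by rewrite {1}[z]surjective_pairing z1 z2 d2 d1 !mulrA.
  have etau : tau o = l * n * m.
    apply: sqr_inj; rewrite sqrtFK -zc {1}ez nformZ mulfK //.
    exact: nform_dir.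
  rewrite /threeline /tangency /= etau -ez -/n.
  by rewrite (_ : l * n * m / n = l * m) ?subaff_scale //; field.
have [s0|s0] := eqVneq (v.1 + w.1) 0.
  by apply: (finish None v.1) => //=; rewrite ?setU11 ?mulr0 ?mulr1 ?s0 ?mulr0 ?addr0.
have sk : (v.1 + w.1) ^+ q = v.1 + w.1 by rewrite !frE v1k w1k.
apply: (finish (Some (t + v.1 / (v.1 + w.1))) (v.1 + w.1)) => //=.
- by rewrite Some_dirs; apply/GFqP; rewrite frD tk frM frV sk v1k.
- apply/eqP => -[] /eqP; rewrite -subr_eq0 addrC addKr mulf_eq0 invr_eq0.
  by rewrite (negPf v10) (negPf s0).
- apply/eqP => -[] /addrI e; case/eqP: w10.
  apply: (addrI v.1); rewrite addr0 -[LHS]mul1r -e mulfVK //.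
- by rewrite mulr1.
- by rewrite [RHS]mulrDr [_ * (v.1 / _)]mulrC mulfVK // addrC [t * _]mulrC.
Qed.

Lemma chord_add z l v w : l != 0 -> chord z l v -> chord z l w -> v != w ->
  chord (shift z l w) l (v.1 + w.1, v.2 + w.2).
Proof.
move=> l0 cv cw vw; have p0 := chord_indep l0 cv cw vw.
move: cv cw => /and3P[/GFq_planeP[v1 v2] v0 /eqP ev] /and3P[/GFq_planeP[w1 w2] w0 /eqP ew].
apply/and3P; split.
- by apply/GFq_planeP; rewrite /= !frE v1 v2 w1 w2.
- apply/eqP => -[/eqF e1 /eqF e2]; case/eqP: p0.
  by rewrite /polar e1 e2; char2.
- apply/eqP; transitivity (l * nform v + l * nform w + l * polar v w).
    by rewrite /nform /polar /=; char2.
  by rewrite ev ew /polar /=; char2.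
Qed.

Lemma chord_self z l w : chord z l w -> chord (shift z l w) l w.
Proof.
move=> /and3P[wk w0 /eqP ew]; apply/and3P; split=> //.
by apply/eqP; rewrite ew /polar /=; char2.
Qed.

(** The sides w and v + w of the triangle z, z + l v, z + l w are the chords from
    its vertex z + l w, to which threeline_special applies. *)
Lemma threeline_apex z l v w k : l != 0 -> nform z = c ->
  chord z l v -> chord z l w -> v != w -> k ^+ q = k ->
  nform (v.1 + w.1, v.2 + w.2) = k * nform w ->
  exists2 x, x \in config & subaff z l = threeline x.1 x.2.
Proof.
move=> l0 zc cv cw vw kk e.
have /and3P[wk w0 _] := cw; have /and3P[vk v0 _] := cv.
rewrite -(subaff_recenter _ _ wk).
apply: threeline_special kk e => //; first 1 last.
- exact: chord_self.
- exact: chord_add.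
- apply: contra_neq v0; rewrite {1}[w]surjective_pairing => -[] /eqP.
  rewrite -subr_eq0 opprD addrCA subrr addr0 oppr_eq0 => /eqP e1 /eqP.
  rewrite -subr_eq0 opprD addrCA subrr addr0 oppr_eq0 => /eqP e2.
  by rewrite [v]surjective_pairing e1 e2.
- by move: cw; rewrite (chordE l0 zc w0) inE => /andP[_ /eqP].
Qed.

(** Since nform v and nform w are combined by coefficients in GF(q), for x v + y w
    to be a chord it suffices that x + 1 + a y = 0 and y + 1 + b x = 0. This system
    is regular: a b = 1 would make a v + w a zero of nform. Its solution has
    nonzero x and y because a and b differ from 1. *)
Lemma fourth_chord z l v w a b : l != 0 ->
  chord z l v -> chord z l w -> v != w -> a ^+ q = a -> b ^+ q = b ->
  polar v w = a * nform v + b * nform w -> a != 1 -> b != 1 ->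
  exists2 u, chord z l u & u != v /\ u != w.
Proof.
move=> l0 cv cw vw ak bk e a1 b1; have p0 := chord_indep l0 cv cw vw.
have /and3P[vk v0 /eqP ev] := cv; have /and3P[wk w0 /eqP ew] := cw.
have [v1k v2k] := GFq_planeP _ vk; have [w1k w2k] := GFq_planeP _ wk.
have ab1 : 1 + a * b != 0.
  apply/eqP => ab; case/eqP: p0.
  have : (a * v.1 + w.1, a * v.2 + w.2) = (0, 0).
    apply: nform_eq0; first by apply/GFq_planeP; rewrite /= !frE ak v1k v2k w1k w2k.
    transitivity (a ^+ 2 * nform v + a * polar v w + nform w).
      by rewrite /nform /polar /=; char2.
    rewrite e; transitivity ((1 + a * b) * nform w); first by char2.
    by rewrite ab mul0r.
  by case=> /eqF e1 /eqF e2; rewrite /polar -e1 -e2; char2.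
have a10 : 1 + a != 0 by rewrite addr_eq0 oppF eq_sym.
have b10 : 1 + b != 0 by rewrite addr_eq0 oppF eq_sym.
pose x := (1 + a) / (1 + a * b); pose y := (1 + b) / (1 + a * b).
have x0 : x != 0 by rewrite mulf_neq0 // invr_eq0.
have y0 : y != 0 by rewrite mulf_neq0 // invr_eq0.
have xk : x ^+ q = x by rewrite /x !frE ak bk.
have yk : y ^+ q = y by rewrite /y !frE ak bk.
have xD : x * (1 + a * b) = 1 + a by rewrite mulfVK.
have yD : y * (1 + a * b) = 1 + b by rewrite mulfVK.
clearbody x y.
have ex : x + 1 + a * y = 0.
  apply: (mulIf ab1); rewrite mul0r.
  transitivity (x * (1 + a * b) + (1 + a * b) + a * (y * (1 + a * b))).
    by ring.
  by rewrite xD yD; char2.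
have ey : y + 1 + b * x = 0.
  apply: (mulIf ab1); rewrite mul0r.
  transitivity (y * (1 + a * b) + (1 + a * b) + b * (x * (1 + a * b))).
    by ring.
  by rewrite xD yD; char2.
pose u := (x * v.1 + y * w.1, x * v.2 + y * w.2).
have pv : polar u v = y * polar v w by rewrite /polar /=; char2.
have pw : polar u w = x * polar v w by rewrite /polar /=; char2.
have pself t : polar t t = 0 by rewrite /polar; char2.
have [uv uw] : u != v /\ u != w.
  split; apply/eqP => eu; [move: pv | move: pw]; rewrite eu pself => /esym/eqP;
  by rewrite mulf_eq0 (negPf p0) ?(negPf x0) ?(negPf y0).
exists u => //; apply/and3P; split.
- by apply/GFq_planeP; rewrite /= !frE xk yk v1k v2k w1k w2k.
- apply/eqP => u0; move/eqP: pv; rewrite u0 /polar /= !mul0r addr0 eq_sym.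
  by rewrite -/(polar v w) mulf_eq0 (negPf y0) (negPf p0).
apply/eqP; transitivity (x * (l * nform v) + y * (l * nform w)); last first.
  by rewrite ev ew /polar /=; ring.
transitivity (l * (x ^+ 2 * nform v + x * y * polar v w + y ^+ 2 * nform w)).
  by rewrite /nform /polar /=; char2.
apply: eqF; rewrite e.
transitivity (l * x * nform v * (x + 1 + a * y) + l * y * nform w * (y + 1 + b * x)).
  by char2.
by rewrite ex ey !mulr0 addr0.
Qed.

(** The coefficients a and b of polar v w over nform v and nform w detect which
    sides of the triangle are separated: a = 1 iff v + w is not separated from w,
    and b = 1 iff v + w is not separated from v. *)
Lemma threeline_of_card3 S : S \in subaffs -> #|S :&: quadric| = 3%N ->
  exists2 x, x \in config & S = threeline x.1 x.2.
Proof.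
case/imsetP=> -[p l]; rewrite inE /= => l0 -> card3.
have /card_gt0P[_ /setIP[/imsetP[u uk ->]]] : (0 < #|subaff p l :&: quadric|)%N.
  by rewrite card3.
rewrite inE => /eqP; move: card3; rewrite -(subaff_recenter p l uk).
move: (shift p l u) => z; rewrite card_subaff_quadric // => card3 zc.
set R := [set u in _ | _] in card3.
have zR : (0, 0) \in R.
  rewrite inE /shift /= !mulr0 !addr0 -surjective_pairing zc eqxx andbT.
  by apply/GFq_planeP; rewrite /= fr0.
move: card3; rewrite (cardsD1 (0, 0)) zR add1n => /succn_inj/eqP/cards2P[v [w [vw eR]]].
have RE u' : u' != (0, 0) -> (u' \in R) = (u' == v) || (u' == w).
  by move=> u0; have /setP/(_ u') := eR; rewrite in_setD1 u0 !inE.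
have vR : v \in R :\ (0, 0) by rewrite eR !inE eqxx.
have wR : w \in R :\ (0, 0) by rewrite eR !inE eqxx orbT.
have cv : chord z l v by move: vR; rewrite in_setD1 => /andP[v0]; rewrite -chordE.
have cw : chord z l w by move: wR; rewrite in_setD1 => /andP[w0]; rewrite -chordE.
have wv : w != v by rewrite eq_sym.
have /and3P[vk v0 _] := cv; have /and3P[wk w0 _] := cw.
have nv0 : nform v != 0 by apply: contra_neq v0 => /(nform_eq0 vk).
pose k := nform w / nform v; have ek : nform w = k * nform v by rewrite mulfVK.
have [/GFqP kk|/GFqP kNk] := boolP (k \in GFq).
  exact: threeline_special l0 zc cv cw vw kk ek.
have [a [b [ak bk e]]] := span_GFq (polar v w / nform v) kNk.
have {}e : polar v w = a * nform v + b * nform w.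
  by rewrite ek mulrA -mulrDl -e mulfVK.
have nvw : nform (v.1 + w.1, v.2 + w.2) = nform v + nform w + polar v w.
  by rewrite /nform /polar /=; char2.
have [a1|a1] := eqVneq a 1.
  apply: (@threeline_apex z l v w (1 + b)) => //; first by rewrite !frE bk.
  by rewrite nvw e a1; char2.
have [b1|b1] := eqVneq b 1.
  apply: (@threeline_apex z l w v (1 + a)) => //; first by rewrite !frE ak.
  by rewrite [w.1 + _]addrC [w.2 + _]addrC nvw e b1; char2.
have [x cx [xv xw]] := fourth_chord l0 cv cw vw ak bk e a1 b1.
have /and3P[xk x0 _] := cx.
by move: cx; rewrite chordE // RE // (negPf xv) (negPf xw).
Qed.

Lemma threelines_eq :
  [set S in subaffs | #|S :&: quadric| == 3%N] =
  [set threeline x.1 x.2 | x in config].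
Proof.
apply/setP => S; rewrite inE; apply/andP/imsetP.
  by case=> SA /eqP /(threeline_of_card3 SA)[x xc ->]; exists x.
case=> x xc ->; rewrite card_threeline //; split=> //.
apply/imsetP; exists (tangency x.2, tau x.2 / nform (1, x.1)) => //=.
move: xc; rewrite !inE => /and4P[/eqP/GFqP tk ok _ _].
by rewrite mulf_neq0 ?invr_eq0 ?tau_neq0 ?nform_dir_neq0 // !inE.
Qed.

Lemma card_threelines :
  #|[set S in subaffs | #|S :&: quadric| == 3%N]| = ((q * (q - 1)) %/ 2)%N.
Proof.
rewrite threelines_eq -card_config.
rewrite (@card_two_to_one _ _ (fun x => threeline x.1 x.2) config).
  by rewrite mulKn.
move=> [t o] xc; have xc1 : (t + 1, o) \in config.
  move: xc; rewrite ![_ \in config]inE /= => /and4P[/GFqS -> -> ot ot1].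
  by rewrite ot1 (_ : t + 1 + 1 = t) ?ot //; char2.
rewrite (_ : [set y in config | _] = [set (t, o); (t + 1, o)]).
  rewrite cards2 xpair_eqE eqxx andbT.
  by rewrite -subr_eq0 opprD addNKr oppr_eq0 oner_eq0.
apply/setP => -[t' o']; rewrite [LHS]in_set !in_set2.
apply/andP/idP => [[yc /eqP/esym e]|].
  by have [/= <- [] ->] := threeline_eq xc yc e; rewrite eqxx ?orbT.
case/orP=> /eqP[-> ->]; rewrite ?xc ?xc1 //=; split=> //; apply/eqP.
by rewrite /threeline nform_dirS.
Qed.

End Counting.

(** * Points and lines in coordinates *)

Definition dot n (v w : 'rV[F]_n) : F := (v *m w^T) 0 0.

Lemma dot_eq0 n (v w : 'rV[F]_n) : (v *m w^T == 0) = (dot v w == 0).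
Proof.
apply/eqP/eqP => [e|e]; first by rewrite /dot e mxE.
by apply/matrixP => i j; rewrite !ord1 [RHS]mxE.
Qed.

Lemma dotE n (v w : 'rV[F]_n) : dot v w = \sum_i v 0 i * w 0 i.
Proof. by rewrite /dot mxE; apply: eq_bigr => i _; rewrite mxE. Qed.

Lemma dotDl n (v v' w : 'rV[F]_n) : dot (v + v') w = dot v w + dot v' w.
Proof. by rewrite /dot mulmxDl mxE. Qed.

Lemma dotZl n k (v w : 'rV[F]_n) : dot (k *: v) w = k * dot v w.
Proof. by rewrite /dot -scalemxAl mxE. Qed.

Lemma dotZr n k (v w : 'rV[F]_n) : dot v (k *: w) = k * dot v w.
Proof. by rewrite /dot linearZ /= -scalemxAr mxE. Qed.

Lemma is_point_span (v : 'rV[F]_3) : v != 0 -> is_point [set a *: v | a : F].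
Proof. by move=> v0; apply/existsP; exists v; rewrite v0 eqxx. Qed.

Definition mkpoint (v : 'rV[F]_3) (v0 : v != 0) : point F :=
  Point (is_point_span v0).

Lemma vectors_span (P : point F) v : has_coords P v ->
  vectors P = [set a *: v | a : F].
Proof.
case: P => X XP /andP[v0 /=]; have /existsP[w /andP[w0 /eqP ->]] := XP.
case/imsetP=> b _ eb; have b0 : b != 0.
  by apply: contra_neq v0 => b0; rewrite eb b0 scale0r.
apply/setP => z; apply/imsetP/imsetP => -[a _ ->].
  by exists (a / b) => //; rewrite eb scalerA mulfVK.
by exists (a * b) => //; rewrite eb scalerA.
Qed.

Lemma coords_exists (P : point F) : exists v, has_coords P v.
Proof.
case: P => X XP; have /existsP[w /andP[w0 /eqP eX]] := XP.
exists w; rewrite /has_coords w0 /= eX; apply/imsetP; exists 1 => //.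
by rewrite scale1r.
Qed.

Lemma coords_mkpoint v (v0 : v != 0) : has_coords (mkpoint v0) v.
Proof.
by rewrite /has_coords v0; apply/imsetP; exists 1; rewrite ?scale1r.
Qed.

Lemma coords_neq0 (P : point F) v : has_coords P v -> v != 0.
Proof. by case/andP. Qed.

Lemma coords_prop (P : point F) v w : has_coords P v -> has_coords P w ->
  exists2 k, k != 0 & w = k *: v.
Proof.
move=> Pv /andP[w0]; rewrite (vectors_span Pv) => /imsetP[k _ ek].
by exists k => //; apply: contra_neq w0 => k0; rewrite ek k0 scale0r.
Qed.

Lemma coordsZ (P : point F) v k : k != 0 -> has_coords P v ->
  has_coords P (k *: v).
Proof.
move=> k0 Pv; rewrite /has_coords scaler_eq0 (negPf k0) (coords_neq0 Pv) /=.
by rewrite (vectors_span Pv); apply: imset_f.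
Qed.

Lemma coords_inj (P Q : point F) v : has_coords P v -> has_coords Q v -> P = Q.
Proof.
by move=> /vectors_span eP /vectors_span eQ; apply: val_inj; rewrite /= eP.
Qed.

Lemma in_line (P : point F) v w : has_coords P v ->
  (P \in line w) = (dot v w == 0).
Proof.
move=> Pv; rewrite inE (vectors_span Pv); apply/forall_inP/eqP => [|e].
  move/(_ v); rewrite dot_eq0 => H; apply/eqP/H/imsetP; exists 1 => //.
  by rewrite scale1r.
by move=> _ /imsetP[a _ ->]; rewrite dot_eq0 dotZl e mulr0.
Qed.

Lemma lineZ k (w : 'rV[F]_3) : k != 0 -> line (k *: w) = line w.
Proof.
move=> k0; apply/setP => P; have [v Pv] := coords_exists P.
by rewrite !(in_line _ Pv) dotZr mulf_eq0 (negPf k0).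
Qed.

(** The affine point x has coordinates hv x 1, the point at infinity with
    direction x has coordinates hv x 0. *)
Definition hv (x : 'rV[F]_2) (a : F) : 'rV[F]_3 := row_mx x (a%:M : 'rV_1).

Lemma dot_hv x a y b : dot (hv x a) (hv y b) = dot x y + a * b.
Proof.
rewrite /dot /hv (@tr_row_mx _ 1 2 1) (@mul_row_col _ 1 2 1 1) mxE.
by rewrite tr_scalar_mx -scalar_mxM [X in _ + X]mxE eqxx mulr1n.
Qed.

Lemma hvZ k x a : k *: hv x a = hv (k *: x) (k * a).
Proof. by rewrite /hv (@scale_row_mx _ 1 2 1) scale_scalar_mx. Qed.

Lemma hv0 x : hv x 0 = row_mx x 0.
Proof. by rewrite /hv raddf0. Qed.

Lemma hv_inj x a y b : hv x a = hv y b -> x = y /\ a = b.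
Proof.
move/(@eq_row_mx _ 1 2 1) => [-> e]; split=> //.
by move/matrixP/(_ 0 0): e; rewrite !mxE eqxx !mulr1n.
Qed.

Lemma hvP (v : 'rV[F]_3) : exists x a, v = hv x a.
Proof.
exists (@lsubmx _ 1 2 1 v), (@rsubmx _ 1 2 1 v 0 0).
by rewrite /hv -mx11_scalar hsubmxK.
Qed.

Lemma hv00 : hv 0 0 = 0.
Proof. by rewrite hv0 (@row_mx0 _ 1 2 1). Qed.

Lemma hv_eq0 x a : (hv x a == 0) = (x == 0) && (a == 0).
Proof.
apply/eqP/andP => [|[/eqP -> /eqP ->]]; last exact: hv00.
by rewrite -hv00 => /hv_inj[-> ->]; rewrite !eqxx.
Qed.

Lemma infty_vec : delta_mx 0 ord_max = hv 0 1.
Proof.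
rewrite /hv; apply/rowP => i; rewrite !mxE eqxx /= -val_eqE /=.
case: splitP => j ->; rewrite !mxE ?ord1 //=.
by case: j => -[|[]].
Qed.

Lemma in_infty (P : point F) x a : has_coords P (hv x a) ->
  (P \in line_at_infinity F) = (a == 0).
Proof.
move=> Px; rewrite /line_at_infinity (in_line _ Px) infty_vec dot_hv mulr1.
by rewrite /dot trmx0 mulmx0 mxE add0r.
Qed.

Lemma hv1_neq0 x : hv x 1 != 0.
Proof. by rewrite hv_eq0 oner_eq0 andbF. Qed.

Definition aff (x : 'rV[F]_2) : point F := mkpoint (hv1_neq0 x).

Lemma coords_aff x : has_coords (aff x) (hv x 1).
Proof. exact: coords_mkpoint. Qed.

Lemma aff_inj : injective aff.
Proof.
move=> x y e; have := coords_aff y; rewrite -e => /(coords_prop (coords_aff x)).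
by case=> k _; rewrite hvZ mulr1 => /hv_inj[-> <-]; rewrite scale1r.
Qed.

Lemma aff_infty x : aff x \notin line_at_infinity F.
Proof. by rewrite (in_infty (coords_aff x)) oner_eq0. Qed.

Lemma affP (P : point F) : P \notin line_at_infinity F -> exists x, P = aff x.
Proof.
have [v Pv] := coords_exists P; have [x [a ev]] := hvP v.
rewrite ev in Pv; rewrite (in_infty Pv) => a0; exists (a^-1 *: x).
apply: coords_inj (coords_aff _); have := coordsZ (invr_neq0 a0) Pv.
by rewrite hvZ mulVf.
Qed.

Lemma in_line_aff x y b : (aff x \in line (hv y b)) = (dot x y + b == 0).
Proof. by rewrite (in_line _ (coords_aff x)) dot_hv mul1r. Qed.

Lemma dot2 (x y : 'rV[F]_2) : dot x y = x 0 0 * y 0 0 + x 0 1 * y 0 1.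
Proof. by rewrite dotE !big_ord_recl big_ord0 addr0 (_ : lift _ _ = 1) //; apply/val_inj. Qed.

Lemma rV2P (x y : 'rV[F]_2) : x 0 0 = y 0 0 -> x 0 1 = y 0 1 -> x = y.
Proof.
move=> e0 e1; apply/rowP => -[[|[|//]] i2].
  by rewrite (_ : Ordinal i2 = 0) //; apply: val_inj.
by rewrite (_ : Ordinal i2 = 1) //; apply: val_inj.
Qed.

Lemma perp_prop (x y w : 'rV[F]_2) : w != 0 -> y != 0 ->
  dot x w = 0 -> dot y w = 0 -> exists k, x = k *: y.
Proof.
move=> w0 y0; rewrite !dot2 => ex ey.
have det0 : x 0 0 * y 0 1 = x 0 1 * y 0 0.
  have [w10|w10] := eqVneq (w 0 1) 0; last first.
    apply: (mulIf w10); apply/eqP; rewrite -subr_eq0; apply/eqP.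
    transitivity (x 0 0 * (y 0 0 * w 0 0 + y 0 1 * w 0 1)
      - y 0 0 * (x 0 0 * w 0 0 + x 0 1 * w 0 1)); first by ring.
    by rewrite ex ey; ring.
  have w00 : w 0 0 != 0.
    by apply: contra_neq w0 => w00; apply: rV2P; rewrite mxE.
  move: ex ey; rewrite w10 !mulr0 !addr0 => /eqP + /eqP.
  rewrite !mulf_eq0 !(negPf w00) !orbF => /eqP -> /eqP ->; by rewrite mul0r mulr0.
have [y00|y00] := eqVneq (y 0 0) 0; last first.
  exists (x 0 0 / y 0 0); apply: rV2P; rewrite !mxE ?mulfVK //.
  by rewrite mulrAC det0 mulfK.
have y10 : y 0 1 != 0.
  by apply: contra_neq y0 => y10; apply: rV2P; rewrite mxE.
exists (x 0 1 / y 0 1); apply: rV2P; rewrite !mxE ?mulfVK //.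
by rewrite mulrAC -det0 mulfK.
Qed.

(** * GF(q)-rational vectors *)

Definition rational n (v : 'rV[F]_n) : bool := map_mx (fun x => x ^+ q) v == v.

Lemma rationalP n (v : 'rV[F]_n) :
  reflect (forall i, v 0 i ^+ q = v 0 i) (rational v).
Proof.
apply: (iffP eqP) => [/rowP e i|e]; first by rewrite -[RHS]e mxE.
by apply/rowP => i; rewrite mxE.
Qed.

Lemma rationalD n (v w : 'rV[F]_n) : rational v -> rational w -> rational (v + w).
Proof.
by move=> /rationalP rv /rationalP rw; apply/rationalP => i; rewrite mxE frD rv rw.
Qed.

Lemma rationalZ n k (v : 'rV[F]_n) : k ^+ q = k -> rational v -> rational (k *: v).
Proof. by move=> kk /rationalP rv; apply/rationalP => i; rewrite mxE frM kk rv. Qed.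

Definition rv2 (z : F * F) : 'rV[F]_2 := \row_i (if i == 0 then z.1 else z.2).

Lemma rv2E z : (rv2 z 0 0 = z.1) * (rv2 z 0 1 = z.2).
Proof. by rewrite !mxE. Qed.

Lemma rv2K (x : 'rV[F]_2) : rv2 (x 0 0, x 0 1) = x.
Proof. by apply: rV2P; rewrite rv2E. Qed.

Lemma rational_rv2 z : rational (rv2 z) = (z \in GFq_plane).
Proof.
apply/rationalP/GFq_planeP => [e|[e0 e1]]; first by rewrite -!rv2E.
by move=> i; rewrite mxE; case: ifP.
Qed.

Lemma rv2_eq0 z : (rv2 z == 0) = (z == (0, 0)).
Proof.
apply/eqP/eqP => [e|->]; last by apply: rV2P; rewrite rv2E mxE.
by rewrite [z]surjective_pairing -!rv2E e !mxE.
Qed.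

Lemma dir_neq0 o : dir o != (0, 0).
Proof. by case: o => [y|]; rewrite xpair_eqE oner_eq0 ?andbF. Qed.

(** The points of a Baer subline, in the frame formed by the rows of W. *)
Lemma card_rational_points (W : 'M[F]_(2, 3)) :
  (forall u : 'rV_2, u *m W = 0 -> u = 0) ->
  #|[set P : point F | [exists u : 'rV[F]_2,
      [&& u != 0, rational u & has_coords P (u *m W)]]]| = q.+1.
Proof.
move=> W_inj; have n0 o : rv2 (dir o) *m W != 0.
  by apply: contra_neq (dir_neq0 o) => /W_inj/eqP; rewrite rv2_eq0 => /eqP.
rewrite -card_dirs -(card_imset _ (f := fun o => mkpoint (n0 o))).
  apply: eq_card => P; rewrite inE; apply/existsP/imsetP; last first.
    case=> o ok ->; exists (rv2 (dir o)); rewrite rational_rv2 dirsP //=.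
    by rewrite rv2_eq0 dir_neq0 coords_mkpoint.
  case=> u /and3P[u0 /rationalP uk Pu].
  have [u00|u00] := eqVneq (u 0 0) 0.
    have u10 : u 0 1 != 0.
      by apply: contra_neq u0 => u10; apply: rV2P; rewrite mxE.
    exists None; first exact: setU11.
    apply: coords_inj (coords_mkpoint _).
    rewrite (_ : rv2 _ = (u 0 1)^-1 *: u); last first.
      by apply: rV2P; rewrite rv2E mxE ?u00 ?mulr0 ?mulVf.
    by rewrite -scalemxAl; apply: coordsZ; rewrite // invr_eq0.
  exists (Some (u 0 1 / u 0 0)).
    by rewrite Some_dirs; apply/GFqP; rewrite !frE !uk.
  apply: coords_inj (coords_mkpoint _).
  rewrite (_ : rv2 _ = (u 0 0)^-1 *: u); last first.
    by apply: rV2P; rewrite rv2E mxE /= ?mulVf // mulrC.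
  by rewrite -scalemxAl; apply: coordsZ; rewrite // invr_eq0.
move=> o o' e; have := coords_mkpoint (n0 o').
rewrite -e => /(coords_prop (coords_mkpoint _))[k _ ek].
have /eqP : rv2 (dir o') - k *: rv2 (dir o) = 0.
  by apply: W_inj; rewrite mulmxBl ek -scalemxAl subrr.
rewrite subr_eq0 => /eqP ed; apply: polar_dir.
by rewrite /polar -!rv2E ed !mxE; char2.
Qed.

Definition c0 : 'I_3 := Ordinal (isT : 0 < 3)%N.
Definition c1 : 'I_3 := Ordinal (isT : 1 < 3)%N.
Definition c2 : 'I_3 := Ordinal (isT : 2 < 3)%N.

Definition vec3 (a b c : F) : 'rV[F]_3 := \row_i [:: a; b; c]`_i.

Lemma vec3E a b c :
  (vec3 a b c 0 c0 = a) * (vec3 a b c 0 c1 = b) * (vec3 a b c 0 c2 = c).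
Proof. by rewrite !mxE. Qed.

Lemma dot3 (v w : 'rV[F]_3) :
  dot v w = v 0 c0 * w 0 c0 + v 0 c1 * w 0 c1 + v 0 c2 * w 0 c2.
Proof.
rewrite dotE !big_ord_recl big_ord0 addr0 addrA.
by congr (_ + _ + _); congr (v 0 _ * w 0 _); apply: val_inj.
Qed.

Lemma ord3P (Q : 'I_3 -> Prop) : Q c0 -> Q c1 -> Q c2 -> forall i, Q i.
Proof.
move=> Q0 Q1 Q2 [[|[|[|//]]] lti];
  by [rewrite (_ : Ordinal lti = c0); [ | apply: val_inj]
     |rewrite (_ : Ordinal lti = c1); [ | apply: val_inj]
     |rewrite (_ : Ordinal lti = c2); [ | apply: val_inj]].
Qed.

Lemma rV3P (v w : 'rV[F]_3) : v 0 c0 = w 0 c0 -> v 0 c1 = w 0 c1 ->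
  v 0 c2 = w 0 c2 -> v = w.
Proof. by move=> e0 e1 e2; apply/rowP; apply: ord3P. Qed.

Definition cross (v w : 'rV[F]_3) : 'rV[F]_3 :=
  vec3 (v 0 c1 * w 0 c2 - v 0 c2 * w 0 c1) (v 0 c2 * w 0 c0 - v 0 c0 * w 0 c2)
       (v 0 c0 * w 0 c1 - v 0 c1 * w 0 c0).

Lemma rational3 (v : 'rV[F]_3) : rational v ->
  [/\ v 0 c0 ^+ q = v 0 c0, v 0 c1 ^+ q = v 0 c1 & v 0 c2 ^+ q = v 0 c2].
Proof. by move/rationalP. Qed.

Lemma rational_cross v w : rational v -> rational w -> rational (cross v w).
Proof.
move=> /rational3[v0 v1 v2] /rational3[w0 w1 w2]; apply/rationalP.
by apply: ord3P; rewrite vec3E !frE ?v0 ?v1 ?v2 ?w0 ?w1 ?w2.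
Qed.

Lemma dot_crossl v w : dot v (cross v w) = 0.
Proof. by rewrite dot3 !vec3E; ring. Qed.

Lemma dot_crossr v w : dot w (cross v w) = 0.
Proof. by rewrite dot3 !vec3E; ring. Qed.

Lemma dotC n (v w : 'rV[F]_n) : dot v w = dot w v.
Proof. by rewrite !dotE; apply: eq_bigr => i _; rewrite mulrC. Qed.

Lemma rV3_neq0 (v : 'rV[F]_3) : v != 0 -> [|| v 0 c0 != 0, v 0 c1 != 0 | v 0 c2 != 0].
Proof.
move=> v0; apply: contraR v0; rewrite !negb_or !negbK => /and3P[/eqP e0 /eqP e1 /eqP e2].
by apply/eqP/rV3P; rewrite mxE.
Qed.

Lemma cross_eq0 v w : v != 0 -> cross v w = 0 -> exists k, w = k *: v.
Proof.
move=> v0 /rowP e; have := e c0; have := e c1; have := e c2; rewrite !vec3E !mxE.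
move=> /eqP; rewrite subr_eq0 => /eqP e2 /eqP; rewrite subr_eq0 => /eqP e1.
move=> /eqP; rewrite subr_eq0 => /eqP e0.
have [x0|x0|x0] := or3P (rV3_neq0 v0).
- exists (w 0 c0 / v 0 c0); apply: rV3P; rewrite mxE; apply: (mulfI x0).
  + by field.
  + by rewrite e2; field.
  + by rewrite -e1; field.
- exists (w 0 c1 / v 0 c1); apply: rV3P; rewrite mxE; apply: (mulfI x0).
  + by rewrite -e2; field.
  + by field.
  + by rewrite e0; field.
- exists (w 0 c2 / v 0 c2); apply: rV3P; rewrite mxE; apply: (mulfI x0).
  + by rewrite e1; field.
  + by rewrite -e0; field.
  + by field.
Qed.

Lemma perp_cross u v w : cross v w != 0 -> dot u v = 0 -> dot u w = 0 ->
  exists k, u = k *: cross v w.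
Proof.
move=> c0' uv uw; apply: cross_eq0 => //.
move: uv uw; rewrite !dot3 => uv uw.
apply: rV3P; rewrite !vec3E mxE;
  [transitivity (w 0 c0 * (u 0 c0 * v 0 c0 + u 0 c1 * v 0 c1 + u 0 c2 * v 0 c2)
    - v 0 c0 * (u 0 c0 * w 0 c0 + u 0 c1 * w 0 c1 + u 0 c2 * w 0 c2))
  |transitivity (w 0 c1 * (u 0 c0 * v 0 c0 + u 0 c1 * v 0 c1 + u 0 c2 * v 0 c2)
    - v 0 c1 * (u 0 c0 * w 0 c0 + u 0 c1 * w 0 c1 + u 0 c2 * w 0 c2))
  |transitivity (w 0 c2 * (u 0 c0 * v 0 c0 + u 0 c1 * v 0 c1 + u 0 c2 * v 0 c2)
    - v 0 c2 * (u 0 c0 * w 0 c0 + u 0 c1 * w 0 c1 + u 0 c2 * w 0 c2))];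
  try (rewrite uv uw !mulr0 subrr; done); ring.
Qed.

(** * The rational points of a frame form a Baer subplane *)

Section Frame.

Variable M : 'M[F]_3.
Hypothesis M_unit : M \in unitmx.

Let N := (invmx M)^T.

Definition frame_points : {set point F} :=
  [set P | [exists v : 'rV[F]_3, [&& v != 0, rational v & has_coords P (v *m M)]]].

(** With these line coordinates, incidence with the point v M is orthogonality of
    w to v. *)
Definition frame_lines : {set {set point F}} :=
  [set line (w *m (invmx M)^T) | w : 'rV[F]_3 & (w != 0) && rational w].

Lemma mulM_eq0 (v : 'rV[F]_3) : (v *m M == 0) = (v == 0).
Proof. by rewrite -(inj_eq (can_inj (mulmxK M_unit)) v 0) mul0mx. Qed.

Lemma mulN_eq0 (v : 'rV[F]_3) : (v *m N == 0) = (v == 0).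
Proof.
have N_unit : N \in unitmx by rewrite unitmx_tr unitmx_inv.
by rewrite -(inj_eq (can_inj (mulmxK N_unit)) v 0) mul0mx.
Qed.

Lemma dot_frame v w : dot (v *m M) (w *m N) = dot v w.
Proof. by rewrite /dot trmx_mul trmxK mulmxA mulmxK. Qed.

Lemma frame_pointsP P :
  reflect (exists v, [/\ v != 0, rational v & has_coords P (v *m M)])
          (P \in frame_points).
Proof.
rewrite inE; apply: (iffP existsP) => -[v].
  by case/and3P; exists v.
by case=> v0 vr Pv; exists v; apply/and3P.
Qed.

Lemma in_frame_line P v w : has_coords P (v *m M) ->
  (P \in line (w *m N)) = (dot v w == 0).
Proof. by move=> Pv; rewrite (in_line _ Pv) dot_frame. Qed.

Definition frame_point (v : 'rV[F]_3) (v0 : v != 0) : point F :=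
  mkpoint (etrans (congr1 negb (mulM_eq0 v)) v0).

Lemma coords_frame_point v (v0 : v != 0) : has_coords (frame_point v0) (v *m M).
Proof. exact: coords_mkpoint. Qed.

Lemma frame_point_in v (v0 : v != 0) : rational v -> frame_point v0 \in frame_points.
Proof.
by move=> vr; apply/frame_pointsP; exists v; rewrite coords_frame_point.
Qed.

Lemma frame_lines_sub : frame_lines \subset lines F.
Proof.
apply/subsetP => _ /imsetP[w /[!inE] /andP[w0 _] ->]; apply/imsetP.
by exists (w *m N); rewrite // inE mulN_eq0.
Qed.

Lemma frame_join P Q : P \in frame_points -> Q \in frame_points -> P != Q ->
  #|[set L in frame_lines | (P \in L) && (Q \in L)]| = 1%N.
Proof.
move=> /frame_pointsP[v [v0 vr Pv]] /frame_pointsP[w [w0 wr Qw]] PQ.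
have c0 : cross v w != 0.
  apply: contra_neq PQ => /(cross_eq0 v0)[k ek]; apply: coords_inj Qw.
  rewrite ek -scalemxAl; apply: coordsZ => //.
  by apply: contra_neq w0 => k0; rewrite ek k0 scale0r.
apply/eqP/cards1P; exists (line (cross v w *m N)); apply/setP => L.
rewrite in_set1 in_set; apply/and3P/eqP => [[]|->]; last first.
  rewrite (in_frame_line _ Pv) (in_frame_line _ Qw) dot_crossl dot_crossr eqxx.
  by split=> //; apply: imset_f; rewrite inE c0 rational_cross.
case/imsetP=> u /[!inE] /andP[u0 _] ->.
rewrite -/N (in_frame_line _ Pv) (in_frame_line _ Qw).
rewrite ![dot _ u]dotC => /eqP uv /eqP uw.
have [k ek] := perp_cross c0 uv uw; rewrite ek -scalemxAl lineZ //.
by apply: contra_neq u0 => k0; rewrite ek k0 scale0r.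
Qed.

Lemma frame_meet L L' : L \in frame_lines -> L' \in frame_lines -> L != L' ->
  #|frame_points :&: L :&: L'| = 1%N.
Proof.
move=> /imsetP[v /[!inE] /andP[v0 vr] ->] /imsetP[w /[!inE] /andP[w0 wr] ->] LL.
have c0 : cross v w != 0.
  apply: contra_neq LL => /(cross_eq0 v0)[k ek].
  rewrite ek -scalemxAl lineZ //.
  by apply: contra_neq w0 => k0; rewrite ek k0 scale0r.
apply/eqP/cards1P; exists (frame_point c0); apply/setP => P.
rewrite in_set1 !in_setI -andbA; apply/and3P/eqP => [[]|->]; last first.
  rewrite -/N !(in_frame_line _ (coords_frame_point c0)) ![dot (cross _ _) _]dotC.
  by rewrite dot_crossl dot_crossr eqxx frame_point_in ?rational_cross.
case/frame_pointsP=> u [u0 _ Pu].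
rewrite -/N !(in_frame_line _ Pu) => /eqP uv /eqP uw.
have [k ek] := perp_cross c0 uv uw; apply: (coords_inj Pu).
rewrite ek -scalemxAl; apply: coordsZ; last exact: coords_frame_point.
by apply: contra_neq u0 => k0; rewrite ek k0 scale0r.
Qed.

(** The plane orthogonal to u is parametrised by the two coordinates other than
    one where u is nonzero. *)
Lemma rational_perp_basis (u : 'rV[F]_3) : u != 0 -> rational u ->
  exists W : 'M[F]_(2, 3), [/\ forall x : 'rV_2, x *m W = 0 -> x = 0,
    forall x : 'rV_2, dot (x *m W) u = 0,
    forall x : 'rV_2, rational x -> rational (x *m W)
    & forall v, rational v -> dot v u = 0 ->
      exists2 x : 'rV_2, rational x & v = x *m W].
Proof.
move=> u0 ur; have [r0 r1 r2] := rational3 ur.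
set goal := ex _; have key (f : F -> F -> 'rV[F]_3) (g : 'rV[F]_3 -> F * F) :
    (forall a b, f a b = a *: f 1 0 + b *: f 0 1) ->
    (forall a b, g (f a b) = (a, b)) ->
    (forall a b, dot (f a b) u = 0) ->
    (forall a b, a ^+ q = a -> b ^+ q = b -> rational (f a b)) ->
    (forall v, rational v -> rational (rv2 (g v))) ->
    (forall v, dot v u = 0 -> v = f (g v).1 (g v).2) -> goal.
- move=> flin gK fu fr gr fK.
  pose W : 'M[F]_(2, 3) := \matrix_(i < 2) (if i == 0 then f 1 0 else f 0 1).
  have WE (x : 'rV_2) : x *m W = f (x 0 0) (x 0 1).
    rewrite flin mulmx_sum_row !big_ord_recl big_ord0 addr0.
    by rewrite !rowK /= (_ : lift _ _ = 1) //; apply: val_inj.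
  exists W; split.
  + move=> x; rewrite WE => e; rewrite -[x]rv2K -(gK (x 0 0) (x 0 1)) e.
    have := gK 0 0; rewrite flin !scale0r addr0 => ->.
    by apply: rV2P; rewrite rv2E mxE.
  + by move=> x; rewrite WE fu.
  + by move=> x /rationalP xr; rewrite WE; apply: fr.
  + move=> v vr vu; exists (rv2 (g v)); first exact: gr.
    by rewrite WE !rv2E; apply: fK.
have [x0|x0|x0] := or3P (rV3_neq0 u0).
- apply: (key (fun a b => vec3 (- (a * u 0 c1 + b * u 0 c2) / u 0 c0) a b)
              (fun v => (v 0 c1, v 0 c2))).
  + by move=> a b; apply: rV3P; rewrite [RHS]mxE [X in _ = X + _]mxE [X in _ = _ + X]mxE !vec3E; field.
  + by move=> a b; rewrite !vec3E.
  + by move=> a b; rewrite dot3 !vec3E; field.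
  + move=> a b ak bk; apply/rationalP.
    by apply: ord3P; rewrite vec3E // !frE ak bk r0 r1 r2.
  + by move=> v /rational3[v0 v1 v2]; rewrite rational_rv2; apply/GFq_planeP.
  + move=> v; rewrite dot3 => e; apply: rV3P; rewrite vec3E //=.
    apply: (mulIf x0); rewrite mulfVK //; apply: eqF; rewrite oppF -[RHS]e; ring.
- apply: (key (fun a b => vec3 a (- (a * u 0 c0 + b * u 0 c2) / u 0 c1) b)
              (fun v => (v 0 c0, v 0 c2))).
  + by move=> a b; apply: rV3P; rewrite [RHS]mxE [X in _ = X + _]mxE [X in _ = _ + X]mxE !vec3E; field.
  + by move=> a b; rewrite !vec3E.
  + by move=> a b; rewrite dot3 !vec3E; field.
  + move=> a b ak bk; apply/rationalP.
    by apply: ord3P; rewrite vec3E // !frE ak bk r0 r1 r2.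
  + by move=> v /rational3[v0 v1 v2]; rewrite rational_rv2; apply/GFq_planeP.
  + move=> v; rewrite dot3 => e; apply: rV3P; rewrite vec3E //=.
    apply: (mulIf x0); rewrite mulfVK //; apply: eqF; rewrite oppF -[RHS]e; ring.
- apply: (key (fun a b => vec3 a b (- (a * u 0 c0 + b * u 0 c1) / u 0 c2))
              (fun v => (v 0 c0, v 0 c1))).
  + by move=> a b; apply: rV3P; rewrite [RHS]mxE [X in _ = X + _]mxE [X in _ = _ + X]mxE !vec3E; field.
  + by move=> a b; rewrite !vec3E.
  + by move=> a b; rewrite dot3 !vec3E; field.
  + move=> a b ak bk; apply/rationalP.
    by apply: ord3P; rewrite vec3E // !frE ak bk r0 r1 r2.
  + by move=> v /rational3[v0 v1 v2]; rewrite rational_rv2; apply/GFq_planeP.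
  + move=> v; rewrite dot3 => e; apply: rV3P; rewrite vec3E //=.
    apply: (mulIf x0); rewrite mulfVK //; apply: eqF; rewrite oppF -[RHS]e; ring.
Qed.

Lemma card_frame_line L : L \in frame_lines -> #|frame_points :&: L| = q.+1.
Proof.
case/imsetP=> u /[!inE] /andP[u0 ur] ->.
have [W [W_inj Wu Wr WK]] := rational_perp_basis u0 ur.
rewrite -(@card_rational_points (W *m M)); last first.
  by move=> x /eqP; rewrite mulmxA mulM_eq0 => /eqP/W_inj.
apply: eq_card => P; rewrite in_setI [RHS]in_set; apply/andP/existsP.
  case=> /frame_pointsP[v [v0 vr Pv]]; rewrite -/N (in_frame_line _ Pv) => /eqP vu.
  have [x xr ev] := WK v vr vu; exists x; rewrite xr mulmxA -ev Pv !andbT.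
  by apply/eqP => x0; case/eqP: v0; rewrite ev x0 mul0mx.
case=> x /and3P[x0 xr]; rewrite mulmxA => Px; split.
  apply/frame_pointsP; exists (x *m W); split=> //; last exact: Wr.
  by apply/eqP => /W_inj e; case/eqP: x0.
by rewrite -/N (in_frame_line _ Px) Wu.
Qed.

(** The three basis points and their sum: a nonzero w is orthogonal to at most
    two of these four vectors. *)
Lemma frame_quadrangle : exists S : {set point F},
  [&& S \subset frame_points, #|S| == 4%N
    & [forall L in frame_lines, (#|S :&: L| <= 2)%N]].
Proof.
have o0 : 1 != 0 :> F by rewrite oner_eq0.
have n0 : vec3 1 0 0 != 0 by apply/eqP => /rowP/(_ c0); rewrite vec3E mxE => /eqP; rewrite oner_eq0.
have n1 : vec3 0 1 0 != 0 by apply/eqP => /rowP/(_ c1); rewrite vec3E mxE => /eqP; rewrite oner_eq0.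
have n2 : vec3 0 0 1 != 0 by apply/eqP => /rowP/(_ c2); rewrite vec3E mxE => /eqP; rewrite oner_eq0.
have n3 : vec3 1 1 1 != 0 by apply/eqP => /rowP/(_ c0); rewrite vec3E mxE => /eqP; rewrite oner_eq0.
pose s := [:: frame_point n0; frame_point n1; frame_point n2; frame_point n3].
have s_uniq : uniq s.
  have neq v w (v0 : v != 0) (w0 : w != 0) : cross v w != 0 ->
      frame_point v0 != frame_point w0.
    apply: contra_neq => e; have := coords_frame_point w0; rewrite -e.
    case/(coords_prop (coords_frame_point v0))=> k _.
    rewrite scalemxAl => /(can_inj (mulmxK M_unit)) ->.
    by apply: rV3P; rewrite vec3E !mxE; ring.
  have cn v w i : cross v w 0 i != 0 -> cross v w != 0.
    by apply: contra_neq => ->; rewrite mxE.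
  pose crossS := (mulr0, mul0r, mulr1, oppr0, addr0, add0r, oppr_eq0, o0).
  rewrite /s /= !inE !negb_or !neq //;
    first [apply: (cn _ _ c0); by rewrite !vec3E !crossS
             |apply: (cn _ _ c1); by rewrite !vec3E !crossS
             |apply: (cn _ _ c2); by rewrite !vec3E !crossS].
exists [set P in s]; apply/and3P; split.
- apply/subsetP => P; rewrite in_set /s !in_cons in_nil orbF.
  case/or4P=> /eqP ->; apply: frame_point_in; apply/rationalP;
    by apply: ord3P; rewrite vec3E ?fr0 ?fr1.
- by rewrite cardsE (card_uniqP s_uniq).
apply/forall_inP => _ /imsetP[u /[!inE] /andP[u0 _] ->]; rewrite -/N.
have -> : #|[set P in s] :&: line (u *m N)| = count (mem (line (u *m N))) s.
  rewrite -size_filter -(card_uniqP (filter_uniq _ s_uniq)).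
  by apply: eq_card => P; rewrite in_setI in_set mem_filter andbC.
rewrite /= !(in_frame_line _ (coords_frame_point _)) !dot3 !vec3E.
rewrite !(mul1r, mul0r, addr0, add0r) addn0.
case: (eqVneq (u 0 c0) 0) (eqVneq (u 0 c1) 0) (eqVneq (u 0 c2) 0)
  => [e0|/negPf e0] [e1|/negPf e1] [e2|/negPf e2];
  rewrite ?e0 ?e1 ?e2 ?add0r ?addr0 ?e0 ?e1 ?e2 //; try by case: eqP.
by case/eqP: u0; apply: rV3P; rewrite mxE.
Qed.

Lemma frame_subplane : subplane q frame_points.
Proof.
apply/existsP; exists frame_lines; rewrite frame_lines_sub /=.
apply/and4P; split.
- by do 2!apply/forall_inP => ? ?; apply/implyP => ?; rewrite frame_join.
- by do 2!apply/forall_inP => ? ?; apply/implyP => ?; rewrite frame_meet.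
- by have [S Sq] := frame_quadrangle; apply/existsP; exists S.
- by apply/forall_inP => L LL; rewrite card_frame_line.
Qed.

End Frame.

(** * Baer subplanes containing a derivation set *)

Lemma join_unique (P Q : point F) w w' : w != 0 -> w' != 0 -> P != Q ->
  P \in line w -> Q \in line w -> P \in line w' -> Q \in line w' ->
  line w = line w'.
Proof.
have [p Pp] := coords_exists P; have [r Qr] := coords_exists Q.
rewrite !(in_line _ Pp) !(in_line _ Qr) ![dot _ w]dotC ![dot _ w']dotC.
move=> w0 w0' PQ /eqP pw /eqP rw /eqP pw' /eqP rw'.
have r0 := coords_neq0 Qr; have c0 : cross p r != 0.
  apply: contra_neq PQ => /(cross_eq0 (coords_neq0 Pp))[k ek].
  apply: coords_inj Qr; rewrite ek; apply: coordsZ => //.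
  by apply: contra_neq r0 => k0; rewrite ek k0 scale0r.
have [k ek] := perp_cross c0 pw rw; have [k' ek'] := perp_cross c0 pw' rw'.
rewrite ek ek' !lineZ //.
  by apply: contra_neq w0' => k0; rewrite ek' k0 scale0r.
by apply: contra_neq w0 => k0; rewrite ek k0 scale0r.
Qed.

Definition det2 (u v : 'rV[F]_2) : F := u 0 0 * v 0 1 - u 0 1 * v 0 0.

Lemma det2Z k u : det2 u (k *: u) = 0.
Proof. by rewrite /det2 !mxE; ring. Qed.

Lemma det2_eq0 u v : u != 0 -> det2 u v = 0 -> exists k, v = k *: u.
Proof.
rewrite /det2 => u0 /eqP; rewrite subr_eq0 => /eqP e.
have [u00|u00] := eqVneq (u 0 0) 0; last first.
  exists (v 0 0 / u 0 0); apply: rV2P; rewrite mxE ?mulfVK //.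
  by apply: (mulfI u00); rewrite e; field.
have u10 : u 0 1 != 0.
  by apply: contra_neq u0 => u10; apply: rV2P; rewrite mxE.
exists (v 0 1 / u 0 1); apply: rV2P; rewrite mxE ?mulfVK //.
by apply: (mulfI u10); rewrite -e; field.
Qed.

Lemma det2_rational u v : rational u -> rational v -> det2 u v ^+ q = det2 u v.
Proof. by move=> /rationalP ur /rationalP vr; rewrite /det2 !frE !ur !vr. Qed.

Lemma rational_indep v : v != 0 -> exists2 w, rational w & det2 v w != 0.
Proof.
move=> v0; have [v00|v00] := eqVneq (v 0 0) 0.
  exists (rv2 (1, 0)); first by rewrite rational_rv2; apply/GFq_planeP; rewrite /= !frE.
  rewrite /det2 !rv2E v00 mul0r mulr1 sub0r oppr_eq0.
  by apply: contra_neq v0 => v10; apply: rV2P; rewrite mxE.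
exists (rv2 (0, 1)); first by rewrite rational_rv2; apply/GFq_planeP; rewrite /= !frE.
by rewrite /det2 !rv2E mulr1 mulr0 subr0.
Qed.

Section Derivation.

Variable A : 'M[F]_2.
Hypothesis A_unit : A \in unitmx.

Let D := baer_subline q A.

Lemma mulA_eq0 (v : 'rV[F]_2) : (v *m A == 0) = (v == 0).
Proof. by rewrite -(inj_eq (can_inj (mulmxK A_unit)) v 0) mul0mx. Qed.

Lemma derivationP P : reflect
  (exists v, [/\ v != 0, rational v & has_coords P (hv (v *m A) 0)]) (P \in D).
Proof.
rewrite inE; apply: (iffP existsP) => -[v].
  by case/and3P=> v0 vr; rewrite /infinite_point -hv0; exists v.
by case=> v0 vr; rewrite hv0 => Pv; exists v; apply/and3P.
Qed.

Lemma derivation_infty : D \subset line_at_infinity F.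
Proof.
by apply/subsetP => P /derivationP[v [_ _ Pv]]; rewrite (in_infty Pv) eqxx.
Qed.

Lemma derivation_point v : v != 0 -> rational v ->
  exists2 P, P \in D & has_coords P (hv (v *m A) 0).
Proof.
move=> v0 vr; have n0 : hv (v *m A) 0 != 0.
  by rewrite hv_eq0 mulA_eq0 (negPf v0).
exists (mkpoint n0); last exact: coords_mkpoint.
by apply/derivationP; exists v; rewrite coords_mkpoint.
Qed.

Lemma card_derivation : #|D| = q.+1.
Proof.
rewrite -(@card_rational_points (row_mx A 0)) => [|u].
  apply: eq_card => P; rewrite [RHS]in_set; apply/derivationP/existsP.
    case=> v [v0 vr Pv]; exists v; rewrite v0 vr /=.
    by rewrite (@mul_mx_row _ 1 2 2 1) mulmx0 -hv0.
  case=> v /and3P[v0 vr]; rewrite (@mul_mx_row _ 1 2 2 1) mulmx0 -hv0.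
  by exists v.
rewrite (@mul_mx_row _ 1 2 2 1) mulmx0 -hv0 => /eqP.
by rewrite hv_eq0 mulA_eq0 eqxx andbT => /eqP.
Qed.

Definition affplane (a : 'rV[F]_2) (l : F) : {set point F} :=
  [set aff (a + l *: (u *m A)) | u : 'rV[F]_2 & rational u].

Section Subplane.

Variables (B : {set point F}) (Ls : {set {set point F}}).
Hypotheses (Ls_lines : Ls \subset lines F) (B_plane : projective_plane q B Ls)
           (DB : D \subset B).

Lemma sub_join P Q : P \in B -> Q \in B -> P != Q ->
  exists L, [/\ L \in Ls, P \in L & Q \in L].
Proof.
move=> PB QB PQ; have /and4P[/forall_inP/(_ P PB)/forall_inP/(_ Q QB) + _ _ _] := B_plane.
rewrite PQ /= => /cards1P[L /setP/(_ L)]; rewrite in_set set11.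
by case/and3P; exists L.
Qed.

Lemma sub_line L : L \in Ls -> exists2 w, w != 0 & L = line w.
Proof.
by move=> LL; have /imsetP[w /[!inE]] := subsetP Ls_lines _ LL; exists w.
Qed.

Lemma sub_meet L L' : L \in Ls -> L' \in Ls -> L != L' ->
  exists P, [/\ P \in B, P \in L & P \in L'].
Proof.
move=> LL LL' ne.
have /and4P[_ /forall_inP/(_ L LL)/forall_inP/(_ L' LL') + _ _] := B_plane.
rewrite ne /= => /cards1P[P /setP/(_ P)]; rewrite set11 !in_setI -andbA.
by case/and3P; exists P.
Qed.

Lemma infty_neq0 : delta_mx 0 ord_max != 0 :> 'rV[F]_3.
Proof. by rewrite infty_vec hv1_neq0. Qed.

(** The line of the subplane joining two points of D is the line at infinity. *)
Lemma infty_in : line_at_infinity F \in Ls.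
Proof.
have /card_gt1P[P [Q [PD QD PQ]]] : (1 < #|D|)%N by rewrite card_derivation ltnS ltnW // q_gt1.
have [L [LL PL QL]] := sub_join (subsetP DB _ PD) (subsetP DB _ QD) PQ.
have [w w0 eL] := sub_line LL; rewrite eL in LL PL QL.
rewrite /line_at_infinity (@join_unique P Q _ w) ?infty_neq0 //.
  exact: (subsetP derivation_infty).
exact: (subsetP derivation_infty).
Qed.

Lemma sub_infty : B :&: line_at_infinity F = D.
Proof.
apply/esym/eqP; rewrite eqEcard subsetI DB derivation_infty card_derivation.
have /and4P[_ _ _ /forall_inP/(_ _ infty_in)/eqP ->] := B_plane.
by rewrite leqnn.
Qed.

(** The line of the subplane joining two affine points meets the line at infinity
    in a point of the subplane, that is, in D. *)
Lemma sub_dir x y : x != y -> aff x \in B -> aff y \in B ->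
  exists v k, [/\ v != 0, rational v & y - x = k *: (v *m A)].
Proof.
move=> xy xB yB; have [|L [LL xL yL]] := sub_join xB yB.
  by apply: contra_neq xy => /aff_inj.
have Linf : L != line_at_infinity F.
  by apply/eqP => e; move: xL; rewrite e (negPf (aff_infty x)).
have [P [PB PL Pinf]] := sub_meet LL infty_in Linf.
have /derivationP[v [v0 vr Pv]] : P \in D by rewrite -sub_infty inE PB.
have [w w0 eL] := sub_line LL; have [z [b ew]] := hvP w.
move: PL xL yL; rewrite eL ew (in_line _ Pv) dot_hv mul0r addr0 !in_line_aff.
move=> /eqP vz /eqP xz /eqP yz; have z0 : z != 0.
  apply: contra_neq w0 => z0; move: xz.
  by rewrite ew z0 /dot trmx0 mulmx0 mxE add0r => ->; rewrite hv00.
have [||k ek] := @perp_prop (y - x) (v *m A) z z0 _ _ vz.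
- by rewrite mulA_eq0.
- by rewrite -scaleN1r dotDl dotZl (eqF yz) (eqF xz) mulN1r subrr.
by exists v, k.
Qed.

(** Two lines of the subplane with different directions in D meet in a point of
    the subplane. *)
Lemma sub_meet_dirs x y t u v k m : aff x \in B -> aff y \in B ->
  rational u -> rational v -> det2 u v != 0 ->
  t - x = k *: (u *m A) -> t - y = m *: (v *m A) -> aff t \in B.
Proof.
move=> xB yB ur vr uv etx ety.
have u0 : u != 0 by apply: contra_neq uv => ->; rewrite /det2 !mxE !mul0r subrr.
have v0 : v != 0 by apply: contra_neq uv => ->; rewrite /det2 !mxE !mulr0 subrr.
have [P PD Pu] := derivation_point u0 ur; have [Q QD Qv] := derivation_point v0 vr.
have PB := subsetP DB _ PD; have QB := subsetP DB _ QD.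
have Pinf := subsetP derivation_infty _ PD.
have Qinf := subsetP derivation_infty _ QD.
have aff_neq z R : R \in line_at_infinity F -> aff z != R.
  by move=> Rinf; apply/eqP => e; move: Rinf; rewrite -e (negPf (aff_infty z)).
have through z w n R L : has_coords R (hv (w *m A) 0) -> L \in Ls ->
    aff z \in L -> R \in L -> t - z = n *: (w *m A) -> aff t \in L.
  move=> Rw LL; have [c _ ->] := sub_line LL; have [d [b ->]] := hvP c.
  rewrite !in_line_aff (in_line _ Rw) dot_hv mul0r addr0 => /eqP zd /eqP Rd e.
  by rewrite -(subrK z t) e dotDl dotZl Rd mulr0 add0r zd.
have [L [LL xL PL]] := sub_join xB PB (aff_neq _ _ Pinf).
have [L' [LL' yL QL]] := sub_join yB QB (aff_neq _ _ Qinf).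
have tL := through _ _ _ _ _ Pu LL xL PL etx.
have tL' := through _ _ _ _ _ Qv LL' yL QL ety.
have [w w0 eL] := sub_line LL; have [w' w0' eL'] := sub_line LL'.
have PQ : P != Q.
  apply/eqP => e; move: Qv; rewrite -e => /(coords_prop Pu)[n _].
  rewrite hvZ => /hv_inj[+ _]; rewrite scalemxAl => /(can_inj (mulmxK A_unit)) ev.
  by case/eqP: uv; rewrite ev det2Z.
have LneL : L != L'.
  apply/eqP => e; move: (tL); rewrite (_ : L = line_at_infinity F).
    by rewrite (negPf (aff_infty t)).
  rewrite eL; apply: (@join_unique P Q) => //; rewrite ?infty_neq0 -?eL //.
  by rewrite e.
have [T [TB TL TL']] := sub_meet LL LL' LneL.
have [<- //|Tt] := eqVneq T (aff t).
case/eqP: LneL; rewrite eL eL'; apply: (join_unique w0 w0' Tt); by rewrite -?eL -?eL'.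
Qed.

(** A quadrangle of the subplane has two affine points a and r, and r - a has a
    direction in D; take a as origin and r - a as l u0 A. A rational point outside
    the line a r is the meet of lines through a and r with directions in D, and a
    rational point of a r is obtained from a rational point outside a r in the
    same way. Conversely, if u is in the subplane, then u and u - w have directions
    in D for every rational w, which forces u to be rational. *)
Lemma sub_affine : exists a l, l != 0 /\ B :\: line_at_infinity F = affplane a l.
Proof.
have [a [r [aB rB ar]]] : exists a r, [/\ aff a \in B, aff r \in B & a != r].
  have /and4P[_ _ /existsP[S /and3P[SB /eqP S4 /forall_inP/(_ _ infty_in) S2]] _] := B_plane.
  have /card_gt1P[P [Q [/setDP[PS Pinf] /setDP[QS Qinf] PQ]]] :
      (1 < #|S :\: line_at_infinity F|)%N.
    rewrite -(leq_add2l 2) (_ : (2 + 2)%N = #|S|) ?S4 //.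
    by rewrite -S4 -(cardsID (line_at_infinity F)) leq_add2r.
  have [x ex] := affP Pinf; have [y ey] := affP Qinf; exists x, y.
  rewrite -ex -ey !(subsetP SB) //; split=> //.
  by apply: contra_neq PQ => e; rewrite ex ey e.
have [u0 [l [u00 u0r e0]]] := sub_dir ar aB rB.
have l0 : l != 0.
  by apply: contra_neq ar => l0; move/eqP: e0; rewrite l0 scale0r subr_eq0 => /eqP.
pose pt u := a + l *: (u *m A).
have pt_sub u v : pt u - pt v = l *: ((u - v) *m A).
  by rewrite /pt opprD addrACA subrr add0r -scalerBr mulmxBl.
have pt_inj : injective pt.
  move=> u v /addrI/(scalerI l0); exact: (can_inj (mulmxK A_unit)).
have ptB0 : aff (pt 0) \in B by rewrite /pt mul0mx scaler0 addr0.
have ptBu0 : aff (pt u0) \in B by rewrite /pt -e0 addrC subrK.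
have dirB u v : u != v -> aff (pt u) \in B -> aff (pt v) \in B ->
    exists w k, rational w /\ v - u = k *: w.
  move=> uv uB vB; have [|w [k [w0 wr]]] := sub_dir _ uB vB.
    by apply: contra_neq uv => /pt_inj.
  rewrite pt_sub scalemxAl => e; exists w, (l^-1 * k); split=> //.
  apply: (can_inj (mulmxK A_unit)); rewrite -scalemxAl -scalerA; rewrite -e.
  by rewrite -scalemxAl scalerA mulVf // scale1r.
have meetB u v t w w' k k' : aff (pt u) \in B -> aff (pt v) \in B ->
    rational w -> rational w' -> det2 w w' != 0 -> t - u = k *: w ->
    t - v = k' *: w' -> aff (pt t) \in B.
  move=> uB vB wr wr' ww e e'.
  apply: (@sub_meet_dirs (pt u) (pt v) (pt t) w w' (l * k) (l * k')) => //;
  by rewrite pt_sub ?e ?e' -scalemxAl scalerA.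
have ratB0 u : rational u -> det2 u0 u != 0 -> aff (pt u) \in B.
  move=> ur du; apply: (@meetB 0 u0 u u (u - u0) 1 1) => //; rewrite ?scale1r ?subr0 //.
    by rewrite -scaleN1r; apply: rationalD => //; apply: rationalZ; rewrite ?frN ?fr1.
  by rewrite (_ : det2 _ _ = det2 u0 u) //; rewrite /det2 !mxE; ring.
have ratB u : rational u -> aff (pt u) \in B.
  move=> ur; have [/det2_eq0[//|k ek]|] := eqVneq (det2 u0 u) 0; last exact: ratB0.
  have [u1 u1r du1] := rational_indep u00.
  apply: (@meetB 0 u1 u u0 (u - u1) k 1); rewrite ?subr0 ?scale1r ?(ratB0 u1) //.
    by rewrite -scaleN1r; apply: rationalD => //; apply: rationalZ; rewrite ?frN ?fr1.
  rewrite (_ : det2 _ _ = - det2 u0 u1) ?oppr_eq0 //.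
  by rewrite ek /det2 !mxE; ring.
have Brat u : aff (pt u) \in B -> rational u.
  move=> uB; have [->|un0] := eqVneq u 0; first by apply/rationalP => i; rewrite mxE fr0.
  have [|v [k [vr]]] := dirB 0 u _ ptB0 uB; first by rewrite eq_sym.
  rewrite subr0 => eu; have v0 : v != 0 by apply: contra_neq un0 => v0; rewrite eu v0 scaler0.
  have [w wr vw] := rational_indep v0; have wB := ratB w wr.
  have wu : w != u by apply: contra_neq vw => ->; rewrite eu det2Z.
  have [v' [k' [vr' e]]] := dirB w u wu wB uB.
  have e1 : det2 v w = k' * det2 v' v.
    transitivity (- det2 v (u - w)); first by rewrite eu /det2 !mxE; ring.
    by rewrite e /det2 !mxE; ring.
  have e2 : k * det2 v w = k' * det2 v' w.
    transitivity (- det2 w (u - w)); first by rewrite eu /det2 !mxE; ring.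
    by rewrite e /det2 !mxE; ring.
  have d0 : det2 v' v != 0 by apply: contra_neq vw => d0; rewrite e1 d0 mulr0.
  have kk' : k' ^+ q = k'.
    have -> : k' = det2 v w / det2 v' v by rewrite e1 mulfK.
    by rewrite frM frV !det2_rational.
  rewrite eu; apply: rationalZ => //.
  have -> : k = k' * det2 v' w / det2 v w by rewrite -e2 mulfK.
  by rewrite !frM frV kk' !det2_rational.
exists a, l; split=> //; apply/setP => P; rewrite in_setD; apply/andP/imsetP.
  case=> Pinf; have [x ->] := affP Pinf => xB.
  pose u := (l^-1 *: (x - a)) *m invmx A.
  have ex : x = pt u.
    by rewrite /pt /u mulmxKV // scalerA mulfV // scale1r addrC subrK.
  exists u; last by rewrite {1}ex.
  by rewrite inE; apply: Brat; rewrite -ex.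
by case=> u; rewrite inE => ur ->; rewrite aff_infty; split=> //; apply: ratB.
Qed.

End Subplane.

(** In homogeneous coordinates, the frame consists of the rows of l A at infinity
    and of the point a. *)
Lemma affplane_subplane a l : l != 0 -> affplane a l \in new_lines q D.
Proof.
move=> l0; pose M : 'M[F]_3 := @block_mx F 2 1 2 1 (l *: A) 0 a 1%:M.
have M_unit : M \in unitmx.
  rewrite unitmxE (@det_lblock F 2 1) det1 mulr1 -unitmxE unitmxZ //.
  by rewrite unitfE.
have hvM u t : hv u t *m M = hv (l *: (u *m A) + t *: a) t.
  rewrite /hv /M (@mul_row_block F 1 2 1 2 1) mulmx0 mulmx1 add0r.
  by rewrite mul_scalar_mx -scalemxAr.
have hv_rat u t : rational (hv u t) <-> rational u /\ t ^+ q = t.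
  have mapS : map_mx (fun x => x ^+ q) (t%:M : 'M[F]_1) = (t ^+ q)%:M.
    by apply/matrixP => i j; rewrite !ord1 !mxE eqxx.
  rewrite /rational {1}/hv (@map_row_mx _ _ _ 1 2 1) mapS -[row_mx _ _]/(hv _ _).
  split=> [/eqP/hv_inj[-> ->]|[/eqP -> ->]] //.
apply/imsetP; exists (frame_points M).
  rewrite inE frame_subplane //=; apply/subsetP => P /derivationP[v [v0 vr Pv]].
  apply/frame_pointsP; exists (hv v 0); split.
  - by rewrite hv_eq0 (negPf v0).
  - by apply/hv_rat; rewrite fr0.
  rewrite hvM scale0r addr0 (_ : hv _ 0 = l *: hv (v *m A) 0); last first.
    by rewrite hvZ mulr0.
  exact: coordsZ.
apply/setP => P; rewrite in_setD; apply/imsetP/andP.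
  case=> u; rewrite inE => ur ->; rewrite aff_infty; split=> //.
  apply/frame_pointsP; exists (hv u 1); rewrite hv1_neq0; split=> //.
    by apply/hv_rat; rewrite fr1.
  by rewrite hvM scale1r addrC; apply: coords_aff.
case=> Pinf /frame_pointsP[v [v0 + +]]; have [u [t ->]] := hvP v.
move=> /hv_rat[ur tk]; rewrite hvM => Pu.
have t0 : t != 0 by move: Pinf; rewrite (in_infty Pu).
exists (t^-1 *: u); first by rewrite inE rationalZ // frV tk.
apply: coords_inj (coords_aff _); have := coordsZ (invr_neq0 t0) Pu.
rewrite hvZ mulVf // scalerDr !scalerA mulVf // scale1r addrC.
by rewrite -scalemxAl scalerA [l * _]mulrC.
Qed.

Lemma new_linesP L : reflect (exists a l, l != 0 /\ L = affplane a l)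
  (L \in new_lines q D).
Proof.
apply: (iffP idP) => [|[a [l [l0 ->]]]]; last exact: affplane_subplane.
case/imsetP=> B; rewrite inE => /andP[/existsP[Ls /andP[Lsub Bpl]] DB] ->.
exact: sub_affine Lsub Bpl DB.
Qed.

Definition affz (o : 'rV[F]_2) (z : F * F) : point F := aff (o + rv2 z *m A).

Lemma affz_inj o : injective (affz o).
Proof.
move=> z z' /aff_inj/addrI/(can_inj (mulmxK A_unit)) e.
by rewrite [z]surjective_pairing [z']surjective_pairing -!rv2E e.
Qed.

Lemma affz_surj o x : exists z, x = o + rv2 z *m A.
Proof.
pose y := (x - o) *m invmx A; exists (y 0 0, y 0 1).
by rewrite rv2K /y mulmxKV // addrC subrK.
Qed.

Lemma affz_subaff o p l : affz o @: subaff p l = affplane (o + rv2 p *m A) l.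
Proof.
have key u : affz o (shift p l u) = aff (o + rv2 p *m A + l *: (rv2 u *m A)).
  rewrite /affz; congr aff; rewrite -addrA scalemxAl -mulmxDl; congr (_ + _ *m _).
  by apply: rV2P; rewrite rv2E !mxE.
apply/setP => P; apply/imsetP/imsetP => [[_ /imsetP[u uk ->] ->]|[u]].
  by exists (rv2 u); rewrite ?inE ?rational_rv2 // key.
rewrite inE -[u]rv2K rational_rv2 => uk ->.
by exists (shift p l (u 0 0, u 0 1)); rewrite ?key //; apply: imset_f.
Qed.

Lemma new_linesE o : new_lines q D = [set affz o @: S | S : {set F * F} in subaffs].
Proof.
apply/setP => L; apply/new_linesP/imsetP => [[a [l [l0 ->]]]|[_ /imsetP[[p l] + ->] ->]].
  have [z ->] := affz_surj o a; exists (subaff z l); last by rewrite affz_subaff.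
  by apply/imsetP; exists (z, l); rewrite ?inE.
by rewrite inE /= => l0; exists (o + rv2 p *m A), l; rewrite affz_subaff.
Qed.

Lemma card_new_lines_meeting o (K : {set point F}) n :
  #|[set L in new_lines q D | #|L :&: K| == n]| =
  #|[set S in subaffs | #|S :&: [set z | affz o z \in K]| == n]|.
Proof.
rewrite -[RHS](card_imset _ (imset_inj (@affz_inj o))); apply: eq_card => L.
have eS (S : {set F * F}) : #|affz o @: S :&: K| = #|S :&: [set z | affz o z \in K]|.
  rewrite -[RHS](card_imset _ (@affz_inj o)); apply: eq_card => P.
  apply/setIP/imsetP => [[/imsetP[z zS ->] zK]|[z /setIP[zS /[!inE] zK] ->]].
    by exists z; rewrite // in_setI zS inE.
  by split=> //; apply: imset_f.
rewrite in_set (new_linesE o); apply/andP/imsetP.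
  by case=> /imsetP[S SA ->] /[!eS] SK; exists S; rewrite // in_set SA.
by case=> S; rewrite in_set => /andP[SA SK] ->; rewrite eS; split=> //; apply: imset_f.
Qed.

End Derivation.

(** * The equation of a conic *)

Definition qpoly (R : comNzRingType) (a b c d e g : R) : {mpoly R[3]} :=
  a%:MP * 'X_c0 ^+ 2 + b%:MP * ('X_c0 * 'X_c1) + c%:MP * 'X_c1 ^+ 2 +
  d%:MP * ('X_c0 * 'X_c2) + e%:MP * ('X_c1 * 'X_c2) + g%:MP * 'X_c2 ^+ 2.

Definition qeval (a b c d e g : F) (x : 'rV[F]_2) (t : F) : F :=
  a * x 0 0 ^+ 2 + b * (x 0 0 * x 0 1) + c * x 0 1 ^+ 2 +
  d * (x 0 0 * t) + e * (x 0 1 * t) + g * t ^+ 2.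

Lemma dhomog2_qpoly (f : {mpoly F[3]}) : f \is 2.-homog ->
  exists a b c d e g, f = qpoly a b c d e g.
Proof.
move/dhomogP => fh; rewrite (mpolyE f) big_seq.
elim/big_rec: _ => [|m p mf [a [b [c [d [e [g ->]]]]]]].
  by exists 0, 0, 0, 0, 0, 0; rewrite /qpoly mpolyC0; ring.
have := fh m mf; rewrite /= mdegE mpolyXE_id !big_ord_recl !big_ord0 mulr1 addn0.
have -> : ord0 = c0 by apply: val_inj.
have -> : lift c0 ord0 = c1 by apply: val_inj.
have -> : lift c0 (lift ord0 ord0) = c2 by apply: val_inj.
move: (m c0) (m c1) (m c2) => i j k; rewrite -mul_mpolyC; set l := f@_m.
have case6 : (i + (j + k))%N = 2%N ->
    [\/ [\/ (i = 2 /\ j = 0 /\ k = 0)%N, (i = 1 /\ j = 1 /\ k = 0)%N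
        | (i = 0 /\ j = 2 /\ k = 0)%N], (i = 1 /\ j = 0 /\ k = 1)%N,
        (i = 0 /\ j = 1 /\ k = 1)%N | (i = 0 /\ j = 0 /\ k = 2)%N].
  case: i j k => [|[|[|i]]] [|[|[|j]]] [|[|[|k]]] //= _;
    by [do 2!constructor 1 | constructor 1; constructor 2
       |constructor 1; constructor 3 | constructor 2 | constructor 3 | constructor 4].
case/case6=> [[]|||] [-> [-> ->]].
- by exists (l + a), b, c, d, e, g; rewrite /qpoly mpolyCD; ring.
- by exists a, (l + b), c, d, e, g; rewrite /qpoly mpolyCD; ring.
- by exists a, b, (l + c), d, e, g; rewrite /qpoly mpolyCD; ring.
- by exists a, b, c, (l + d), e, g; rewrite /qpoly mpolyCD; ring.
- by exists a, b, c, d, (l + e), g; rewrite /qpoly mpolyCD; ring.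
- by exists a, b, c, d, e, (l + g); rewrite /qpoly mpolyCD; ring.
Qed.

Lemma hvE x t : (hv x t 0 c0 = x 0 0) * (hv x t 0 c1 = x 0 1) * (hv x t 0 c2 = t).
Proof.
rewrite /hv.
have -> : c0 = @lshift 2 1 0 by apply: val_inj.
have -> : c1 = @lshift 2 1 1 by apply: val_inj.
have -> : c2 = @rshift 2 1 0 by apply: val_inj.
by rewrite !(@row_mxEl _ 1 2 1) (@row_mxEr _ 1 2 1) mxE eqxx.
Qed.

Lemma meval_qpoly a b c d e g x t :
  (qpoly a b c d e g).@[fun i => hv x t 0 i] = qeval a b c d e g x t.
Proof. by rewrite /qpoly /qeval !(mevalD, mevalM, rmorphXn, mevalC, mevalXU) /= !hvE. Qed.

Lemma qevalZ a b c d e g k x t :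
  qeval a b c d e g (k *: x) (k * t) = k ^+ 2 * qeval a b c d e g x t.
Proof. by rewrite /qeval !mxE; ring. Qed.

Lemma in_zero_set a b c d e g (P : point F) x t : has_coords P (hv x t) ->
  (P \in zero_set (qpoly a b c d e g)) = (qeval a b c d e g x t == 0).
Proof.
move=> Px; rewrite inE (vectors_span Px); apply/forall_inP/eqP => [|ex].
  move/(_ (hv x t)); rewrite meval_qpoly => H; apply/eqP/H/imsetP; exists 1 => //.
  by rewrite scale1r.
by move=> _ /imsetP[k _ ->]; rewrite hvZ meval_qpoly qevalZ ex mulr0.
Qed.

(** A quadratic form in two linear forms splits over an algebraically closed
    field, and its factors are not units since they vanish at o. *)
Lemma cone_reducible (f : {mpoly F[3]}) a b c (o : 'rV[F]_2) :
  f = a%:MP * ('X_c0 - (o 0 0)%:MP * 'X_c2) ^+ 2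
    + b%:MP * (('X_c0 - (o 0 0)%:MP * 'X_c2) * ('X_c1 - (o 0 1)%:MP * 'X_c2))
    + c%:MP * ('X_c1 - (o 0 1)%:MP * 'X_c2) ^+ 2 ->
  ~ absolutely_irreducible f.
Proof.
move=> ef irr; have [L [iota _]] := countable_algebraic_closure F.
have [_ _ {}irr] := irr L iota.
pose X : {mpoly L[3]} := 'X_c0 - (iota (o 0 0))%:MP * 'X_c2.
pose Y : {mpoly L[3]} := 'X_c1 - (iota (o 0 1))%:MP * 'X_c2.
pose v (i : 'I_3) : L := [:: iota (o 0 0); iota (o 0 1); 1]`_i.
have X0 : X.@[v] = 0.
  by rewrite /X mevalB mevalM mevalC !mevalXU /v /= mulr1 subrr.
have Y0 : Y.@[v] = 0.
  by rewrite /Y mevalB mevalM mevalC !mevalXU /v /= mulr1 subrr.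
have fE : map_mpoly iota f =
    (iota a)%:MP * X ^+ 2 + (iota b)%:MP * (X * Y) + (iota c)%:MP * Y ^+ 2.
  by rewrite ef !(rmorphXn, rmorphD, rmorphN, rmorphM) /= !map_mpolyC !map_mpolyX.
have nunit g : g.@[v] = 0 -> g \is a @GRing.unit {mpoly L[3]} -> False.
  move=> g0 gU; have := congr1 (meval v) (mulrV gU).
  rewrite mevalM g0 mul0r rmorph1 => /esym/eqP; by rewrite oner_eq0.
have [a0|a0] := eqVneq (iota a) 0.
  have [] := irr Y ((iota b)%:MP * X + (iota c)%:MP * Y).
  - by rewrite fE a0 mpolyC0; ring.
  - exact: nunit.
  - by apply: nunit; rewrite mevalD !mevalM X0 Y0 !mulr0 addr0.
have [s] := @solve_monicpoly L 2 (fun i => [:: - iota c / iota a; - iota b / iota a]`_i) isT.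
rewrite !big_ord_recl big_ord0 /= expr0 expr1 mulr1 addr0 => es.
have ec : iota c = - (s * (iota a * s + iota b)).
  transitivity (- (iota a * s ^+ 2 + iota b * s)); last by ring.
  by rewrite es; field.
have [] := irr (X - s%:MP * Y) ((iota a)%:MP * X + (iota a * s + iota b)%:MP * Y).
- by rewrite fE ec mpolyCN !mpolyCM mpolyCD mpolyCM; ring.
- by apply: nunit; rewrite mevalB mevalM X0 Y0 mulr0 subrr.
- by apply: nunit; rewrite mevalD !mevalM X0 Y0 !mulr0 addr0.
Qed.

(** * Normal form of ellipses and hyperbolas *)

Definition qform (a b c : F) (x : 'rV[F]_2) : F :=
  a * x 0 0 ^+ 2 + b * (x 0 0 * x 0 1) + c * x 0 1 ^+ 2.

Lemma qeval_infty a b c d e g x : qeval a b c d e g x 0 = qform a b c x.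
Proof. by rewrite /qeval /qform; ring. Qed.

Lemma mulmx2E (x : 'rV[F]_2) (A : 'M[F]_2) j :
  (x *m A) 0 j = x 0 0 * A 0 j + x 0 1 * A 1 j.
Proof.
rewrite mxE !big_ord_recl big_ord0 addr0.
by rewrite (_ : lift _ _ = 1) //; apply: val_inj.
Qed.

Lemma det_mx22 (A : 'M[F]_2) : \det A = A 0 0 * A 1 1 - A 0 1 * A 1 0.
Proof.
rewrite (expand_det_row _ 0) !big_ord_recl big_ord0 addr0 /cofactor !det_mx11 !mxE.
have -> : lift 0 0 = 1 :> 'I_2 by apply: val_inj.
have -> : lift 1 0 = 0 :> 'I_2 by apply: val_inj.
by rewrite /= addn0 expr0 expr1; ring.
Qed.

Lemma qform_frame a b c (A : 'M[F]_2) x :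
  qform a b c (x *m A) = qform
    (a * A 0 0 ^+ 2 + b * (A 0 0 * A 0 1) + c * A 0 1 ^+ 2) (b * \det A)
    (a * A 1 0 ^+ 2 + b * (A 1 0 * A 1 1) + c * A 1 1 ^+ 2) x.
Proof. by rewrite det_mx22 /qform !mulmx2E; char2. Qed.

Definition mx22 (a b c d : F) : 'M[F]_2 :=
  \matrix_(i < 2, j < 2) (if i == 0 then if j == 0 then a else b
                          else if j == 0 then c else d).

Lemma mx22E a b c d : (mx22 a b c d 0 0 = a) * (mx22 a b c d 0 1 = b) *
  (mx22 a b c d 1 0 = c) * (mx22 a b c d 1 1 = d).
Proof. by rewrite !mxE. Qed.

(** A form without zeros on GF(q)^2 whose coefficients are not all in GF(q) can
    be normalised by a substitution over GF(q): the part of the form outside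
    GF(q) is the square of a linear form, whose kernel is spanned by the second
    basis vector. *)
Lemma normal_form a c :
  (forall u, rational u -> u != 0 -> qform a 1 c u != 0) ->
  ~ (a ^+ q = a /\ c ^+ q = c) ->
  exists (G : 'M[F]_2) (al k : F),
    [/\ G \in unitmx, forall u, rational u -> rational (u *m G),
        al ^+ q <> al, k != 0
      & forall z, qform a 1 c (rv2 z *m G) = k * nform al z].
Proof.
move=> aniso acNk.
have G_rat r s t u : r ^+ q = r -> s ^+ q = s -> t ^+ q = t -> u ^+ q = u ->
    forall v, rational v -> rational (v *m mx22 r s t u).
  move=> rk sk tk uk v /rationalP vr.
  rewrite -[v *m _]rv2K rational_rv2; apply/GFq_planeP.
  by rewrite /= !mulmx2E !mx22E !frE !vr rk sk tk uk.
have NkM (g x : F) : g != 0 -> g ^+ q = g -> x ^+ q <> x -> (g * x) ^+ q <> g * x.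
  by move=> g0 gk xNk; rewrite frM gk => /(mulfI g0).
have [ck|cNk] := eqVneq (c ^+ q) c.
  have c_neq0 : c != 0.
    have <- : qform a 1 c (rv2 (0, 1)) = c by rewrite /qform !rv2E /=; ring.
    apply: aniso; last by rewrite rv2_eq0 xpair_eqE eqxx oner_eq0.
    by rewrite rational_rv2; apply/GFq_planeP; rewrite /= !frE.
  exists (mx22 c 0 0 1), (c * a), c; split=> //.
  - by rewrite unitmxE det_mx22 !mx22E mulr1 mulr0 subr0 unitfE.
  - by apply: G_rat; rewrite ?fr0 ?fr1.
  - by apply: NkM => // ak; apply: acNk.
  - by move=> z; rewrite /qform !mulmx2E !mx22E !rv2E /nform; ring.
have d0 : c + c ^+ q != 0.
  by apply/negP => /eqP /eqF e; case/eqP: cNk; rewrite -e.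
pose r := sqrtF ((a + a ^+ q) / (c + c ^+ q)).
have rk : r ^+ q = r.
  apply: sqrtF_GFq; rewrite !frE !frK.
  by rewrite [a ^+ q + _]addrC [c ^+ q + _]addrC.
have er : r ^+ 2 * (c + c ^+ q) = a + a ^+ q by rewrite sqrtFK mulfVK.
clearbody r.
pose g := a + r + c * r ^+ 2.
have gk : g ^+ q = g.
  rewrite /g !frE rk; apply: eqF.
  transitivity (a + a ^+ q + r ^+ 2 * (c + c ^+ q)); first by char2.
  by rewrite er; char2.
have g0 : g != 0.
  have -> : g = qform a 1 c (rv2 (1, r)) by rewrite /qform !rv2E /g /=; ring.
  apply: aniso; last by rewrite rv2_eq0 xpair_eqE oner_eq0.
  by rewrite rational_rv2; apply/GFq_planeP; rewrite /= fr1.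
exists (mx22 0 g 1 r), (g * c), g; split=> //.
- by rewrite unitmxE det_mx22 !mx22E mulr1 mul0r sub0r unitfE oppr_eq0.
- by apply: G_rat; rewrite ?fr0 ?fr1.
- by apply: NkM => //; apply/eqP.
- by move=> z; rewrite /qform !mulmx2E !mx22E !rv2E /nform /g /=; char2.
Qed.

(** One inclusion suffices, as all Baer sublines have q + 1 points. *)
Lemma baer_subline_frame (G A : 'M[F]_2) : A \in unitmx -> G \in unitmx ->
  (forall u, rational u -> rational (u *m G)) ->
  baer_subline q (G *m A) = baer_subline q A.
Proof.
move=> AU GU Gr; have GAU : G *m A \in unitmx by rewrite unitmx_mul GU.
apply/eqP; rewrite eqEcard !card_derivation // leqnn andbT.
apply/subsetP => P /(derivationP (G *m A))[v [v0 vr Pv]].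
apply/(derivationP A); exists (v *m G); rewrite -mulmxA; split=> //.
  by rewrite (mulA_eq0 GU).
exact: Gr.
Qed.

Section Conic.

Variables (A : 'M[F]_2) (a b c d e g : F).
Hypothesis A_unit : A \in unitmx.

Let f := qpoly a b c d e g.
Let K := zero_set f.
Let D := baer_subline q A.

Lemma in_infinite_points P x : has_coords P (hv x 0) ->
  (P \in infinite_points K) = (qform a b c x == 0).
Proof.
by move=> Px; rewrite inE (in_infty Px) eqxx andbT (in_zero_set _ _ _ _ _ _ Px) qeval_infty.
Qed.

Lemma infinite_vec P : P \in line_at_infinity F ->
  exists2 x, x != 0 & has_coords P (hv x 0).
Proof.
have [v Pv] := coords_exists P; have [x [t ev]] := hvP v; rewrite ev in Pv.
rewrite (in_infty Pv) => /eqP t0; rewrite t0 in Pv; exists x => //.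
by have := coords_neq0 Pv; rewrite hv_eq0 eqxx andbT.
Qed.

(** In characteristic 2, without a mixed term the form at infinity is the square
    of a linear form, which has one zero or vanishes identically. *)
Lemma middle_neq0 : #|infinite_points K| = 0%N \/ #|infinite_points K| = 2%N ->
  b != 0.
Proof.
move=> cardK; apply/eqP => b0.
have qE x : qform a b c x = (sqrtF a * x 0 0 + sqrtF c * x 0 1) ^+ 2.
  rewrite /qform b0 -{1}(sqrtFK a) -{1}(sqrtFK c); char2.
have [ac0|ac0] := eqVneq (rv2 (sqrtF c, sqrtF a)) 0.
  have a0 : sqrtF a = 0 by have := congr1 (fun x : 'rV_2 => x 0 1) ac0; rewrite rv2E mxE.
  have c_0 : sqrtF c = 0 by have := congr1 (fun x : 'rV_2 => x 0 0) ac0; rewrite rv2E mxE.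
  have : (#|D| <= #|infinite_points K|)%N.
    apply: subset_leq_card; apply/subsetP => P PD.
    have [x x0 Px] := infinite_vec (subsetP (derivation_infty _) _ PD).
    by rewrite (in_infinite_points Px) qE a0 c_0 !mul0r addr0 expr0n.
  by rewrite card_derivation //; case: cardK => ->; rewrite ?ltn0 // ltnS leqNgt q_gt1.
have n0 : hv (rv2 (sqrtF c, sqrtF a)) 0 != 0 by rewrite hv_eq0 (negPf ac0).
suff K1 : infinite_points K = [set mkpoint n0].
  by move: cardK; rewrite K1 cards1; case.
apply/setP => P; rewrite in_set1; apply/idP/eqP => [PK|->]; last first.
  by rewrite (in_infinite_points (coords_mkpoint n0)) qE !rv2E /= sqrf_eq0; apply/eqP; char2.
have /setIP[_ Pinf] := PK; have [x x0 Px] := infinite_vec Pinf.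
move: PK; rewrite (in_infinite_points Px) qE sqrf_eq0 => /eqP/eqF ex.
have [k ek] : exists k, x = k *: rv2 (sqrtF c, sqrtF a).
  apply: det2_eq0 => //; rewrite /det2 !rv2E ex /=; char2.
have k0 : k != 0 by apply: contra_neq x0 => k0; rewrite ek k0 scale0r.
apply: coords_inj Px _; have := coordsZ k0 (coords_mkpoint n0).
by rewrite hvZ mulr0 -ek.
Qed.

(** The partial derivatives of the equation by both affine coordinates vanish at
    the nucleus o, so that no linear terms remain if o is the origin. *)
Lemma qeval_center (o x : 'rV[F]_2) t : e = b * o 0 0 -> d = b * o 0 1 ->
  qeval a b c d e g (t *: o + x) t =
  qform a b c x + qeval a b c d e g o 1 * t ^+ 2.
Proof. by move=> -> ->; rewrite /qeval /qform !mxE; char2. Qed.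

(** Otherwise K would be a pair of lines through o. *)
Lemma center_notin (o : 'rV[F]_2) : e = b * o 0 0 -> d = b * o 0 1 ->
  absolutely_irreducible f -> qeval a b c d e g o 1 != 0.
Proof.
move=> ee ed irr; apply/eqP => q0; apply: (@cone_reducible f a b c o _ irr).
have {q0} eg : g = a * (o 0 0 * o 0 0) + b * (o 0 0 * o 0 1) + c * (o 0 1 * o 0 1).
  by apply: eqF; rewrite -[RHS]q0 /qeval ee ed; char2.
have two0P : 2 = 0 :> {mpoly F[3]}.
  by rewrite -(mpolyC_nat 3 F 2) two0 mpolyC0.
rewrite /f /qpoly eg ee ed !(mpolyCD, mpolyCM).
by apply/eqP; rewrite -subr_eq0; apply/eqP; ring: two0P.
Qed.

Lemma card_new_lines_three : absolutely_irreducible f -> b != 0 ->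
  (forall u, rational u -> u != 0 -> qform a b c (u *m A) != 0) ->
  ~ (exists r s k, [/\ r ^+ q = r, s ^+ q = s, k != 0
       & forall x, qform a b c (x *m A) = k * qform r 1 s x]) ->
  #|[set L in new_lines q D | #|L :&: K| == 3%N]| = ((q * (q - 1)) %/ 2)%N.
Proof.
move=> irr b0 aniso nrat.
pose r := qform a b c (rv2 (1, 0) *m A) / (b * \det A).
pose s := qform a b c (rv2 (0, 1) *m A) / (b * \det A).
have k0 : b * \det A != 0 by rewrite mulf_neq0 // -unitfE -unitmxE.
have formE x : qform a b c (x *m A) = b * \det A * qform r 1 s x.
  rewrite /r /s !qform_frame; move: (b * \det A) k0 => k k0.
  by rewrite /qform !rv2E /=; field.
have [u ur u0|[rk sk]|G [al [m [GU Gr alNk m0 normE]]]] := @normal_form r s.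
- by move: (aniso u ur u0); rewrite formE mulf_eq0 => /norP[].
- by apply: nrat; exists r, s, (b * \det A).
pose o := rv2 (e / b, d / b).
have ee : e = b * o 0 0 by rewrite rv2E /=; field.
have ed : d = b * o 0 1 by rewrite rv2E /=; field.
have c'0 := center_notin ee ed irr; set c' := qeval _ _ _ _ _ _ _ _ in c'0.
have GAU : G *m A \in unitmx by rewrite unitmx_mul GU.
have bm0 : b * \det A * m != 0 by rewrite mulf_neq0.
have cc0 : c' / (b * \det A * m) != 0 by rewrite mulf_neq0 // invr_eq0.
rewrite /D -(baer_subline_frame A_unit GU Gr) (card_new_lines_meeting GAU o).
rewrite -(card_threelines alNk cc0).
suff -> : [set z | affz (G *m A) o z \in K] = quadric al (c' / (b * \det A * m)) by [].
apply/setP => z; rewrite in_set [RHS]in_set /affz /K /f (in_zero_set _ _ _ _ _ _ (coords_aff _)).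
rewrite -{1}[o]scale1r qeval_center // mulmxA formE normE -/c' expr1n mulr1.
rewrite addr_eq0 oppF mulrA -[RHS](inj_eq (mulfI bm0)).
by rewrite [_ * (c' / _)]mulrC mulfVK.
Qed.

(** A form over GF(q) splits over GF(q^2), which would give an infinite point. *)
Lemma ellipse_nonrational : #|infinite_points K| = 0%N ->
  ~ (exists r s k, [/\ r ^+ q = r, s ^+ q = s, k != 0
       & forall x, qform a b c (x *m A) = k * qform r 1 s x]).
Proof.
move=> K0 [r [s [k [rk sk k0 formE]]]].
have noz x : x != 0 -> qform r 1 s x != 0.
  move=> x0; apply/eqP => e0.
  have n0 : hv (x *m A) 0 != 0 by rewrite hv_eq0 mulA_eq0 ?(negPf x0).
  move/cards0_eq/setP/(_ (mkpoint n0)): K0; rewrite in_set0.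
  by rewrite (in_infinite_points (coords_mkpoint _)) formE e0 mulr0 eqxx.
have [r0|r0] := eqVneq r 0.
  have : rv2 (1, 0) != 0 by rewrite rv2_eq0 xpair_eqE oner_eq0.
  move/noz/eqP; apply; rewrite /qform !rv2E r0 /=; ring.
have [|t et] := @artin_schreier (r * s); first by rewrite frM rk sk.
have : rv2 (t / r, 1) != 0 by rewrite rv2_eq0 xpair_eqE oner_eq0 andbF.
move/noz/eqP; apply; rewrite /qform !rv2E /=.
transitivity ((t ^+ 2 + t) / r + s); first by field.
by rewrite et; apply: eqF; rewrite mulrAC mulfV // mul1r; char2.
Qed.

(** The Frobenius map sends a zero of a form over GF(q) to a zero, and it moves
    all points at infinity outside D. *)
Lemma hyperbola_nonrational : #|infinite_points K| = 2%N ->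
  (forall P Q : point F, P \in infinite_points K ->
              Q \in infinite_points K -> P != Q -> ~ conjugate_points q D P Q) ->
  [disjoint infinite_points K & D] ->
  ~ (exists r s k, [/\ r ^+ q = r, s ^+ q = s, k != 0
       & forall x, qform a b c (x *m A) = k * qform r 1 s x]).
Proof.
move=> K2 nconj disj [r [s [k [rk sk k0 formE]]]].
have /card_gt0P[P PK] : (0 < #|infinite_points K|)%N by rewrite K2.
have PND := disjointFr disj PK.
have /setIP[_ Pinf] := PK; have [y y0 Py] := infinite_vec Pinf.
pose x := y *m invmx A; have ey : y = x *m A by rewrite mulmxKV.
rewrite ey in y0 Py; clearbody x.
move: PK; rewrite (in_infinite_points Py) formE mulf_eq0 (negPf k0) /= => /eqP x0.
have fx : qform r 1 s (frobenius q x) = 0.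
  rewrite -[RHS]fr0 -x0 /qform !frE rk sk !mxE //.
have fx_neq0 : frobenius q x != 0.
  apply: contra_neq y0 => fx0; apply/eqP; rewrite mulA_eq0 //; apply/eqP.
  apply: rV2P; rewrite mxE -[LHS]frK.
    by have := congr1 (fun z : 'rV_2 => z 0 0) fx0; rewrite !mxE => ->; rewrite fr0.
  by have := congr1 (fun z : 'rV_2 => z 0 1) fx0; rewrite !mxE => ->; rewrite fr0.
have n0 : hv (frobenius q x *m A) 0 != 0 by rewrite hv_eq0 mulA_eq0 ?(negPf fx_neq0).
have PK : P \in infinite_points K by rewrite (in_infinite_points Py) formE x0 mulr0.
have QK : mkpoint n0 \in infinite_points K.
  by rewrite (in_infinite_points (coords_mkpoint _)) formE fx mulr0.
apply: (nconj _ _ PK QK); last first.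
  exists A; split=> //; exists x; rewrite /infinite_point -!hv0; split=> //.
  exact: coords_mkpoint.
(* A fixed direction would be rational up to a scalar, hence in D. *)
apply/eqP => eP; move: (coords_mkpoint n0); rewrite -eP => /(coords_prop Py)[m m0].
rewrite hvZ => /hv_inj[+ _]; rewrite scalemxAl => /(can_inj (mulmxK A_unit)) efx.
have fx00 : x 0 0 ^+ q = m * x 0 0.
  by have := congr1 (fun z : 'rV_2 => z 0 0) efx; rewrite !mxE.
have fx01 : x 0 1 ^+ q = m * x 0 1.
  by have := congr1 (fun z : 'rV_2 => z 0 1) efx; rewrite !mxE.
have inD i : x 0 i != 0 -> x 0 i ^+ q = m * x 0 i -> P \in D.
  move=> xi0 fxi; apply/(derivationP A); exists ((x 0 i)^-1 *: x); split.
  - rewrite scaler_eq0 invr_eq0 (negPf xi0) /=.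
    by apply: contra_neq xi0 => ->; rewrite mxE.
  - rewrite -[_ *: x]rv2K rational_rv2; apply/GFq_planeP.
    by rewrite /= !mxE !frM frV fxi fx00 fx01; split; field; rewrite xi0 m0.
  rewrite -scalemxAl (_ : hv _ 0 = (x 0 i)^-1 *: hv (x *m A) 0); last first.
    by rewrite hvZ mulr0.
  by apply: coordsZ; rewrite // invr_eq0.
move/negP: PND; apply; have [x00|x00] := eqVneq (x 0 0) 0; last exact: inD fx00.
apply: (inD 1) => //; apply: contra_neq y0 => x10.
by apply/eqP; rewrite mulA_eq0 //; apply/eqP/rV2P; rewrite mxE.
Qed.

End Conic.

End HallPlane.

Theorem theorem9p1 (F : finFieldType) (q h : nat)
    (h_gt0 : (0 < h)%N) (q_pow2 : q = (2 ^ h)%N) (cardF : #|F| = (q ^ 2)%N)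
    (D : {set point F}) (D_derivation : derivation_set q D)
    (K : {set point F})
    (K_type : ellipse K \/
       [/\ hyperbola K,
           (forall P Q : point F, P \in infinite_points K ->
              Q \in infinite_points K -> P != Q -> ~ conjugate_points q D P Q)
         & [disjoint infinite_points K & D]]) :
  #|[set L in new_lines q D | #|L :&: K| == 3]| = ((q * (q - 1)) %/ 2)%N.
Proof.
have [A A_unit eD] := D_derivation.
have [f [f_homog f_irr eK]] : conic K by case: K_type => [[]|[[]]].
have disj : [disjoint infinite_points K & D].
  case: K_type => [[_ /eqP]|[]//]; rewrite cards_eq0 => /eqP ->.
  by rewrite -setI_eq0 set0I.
have cardK : #|infinite_points K| = 0%N \/ #|infinite_points K| = 2%N.
  by case: K_type => [[]|[[]]]; [left | right].
have [a [b [c [d [e [g ef]]]]]] := dhomog2_qpoly f_homog.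
rewrite eD eK ef in K_type disj cardK *; rewrite ef in f_irr.
apply: (card_new_lines_three h_gt0 q_pow2 cardF A_unit f_irr).
- exact: (middle_neq0 h_gt0 q_pow2 cardF A_unit cardK).
- move=> u ur u0; apply/eqP => qu0.
  have [P PD Pu] := derivation_point A_unit u0 ur.
  have := disjointFl disj PD.
  by rewrite (in_infinite_points _ _ _ _ _ _ Pu) qu0 eqxx.
case: K_type => [[_ K0]|[[_ K2] nconj _]].
  exact: (ellipse_nonrational h_gt0 q_pow2 cardF A_unit K0).
exact: (hyperbola_nonrational h_gt0 q_pow2 cardF A_unit K2 nconj disj).
Qed.
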